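(* ${\sf C}\mbox{-}{\sf perm}\le_{m}^{p}{\sf planar}\mbox{-}{\sf C}\mbox{-}{\sf perm}$ and ${\sf C}\mbox{-}{\sf det}\le_{m}^{p}{\sf planar}\mbox{-}{\sf C}\mbox{-}{\sf det}$, and these polynomial-time many-one reductions work over any non-commutative algebra.
   Context: Let $R$ be an associative (possibly non-commutative) algebra with identity. For a weighted directed graph $G$ on $[n]$ with edge weights $w(i,j)\in R$ ($0$ for non-edges), ${\sf C}\mbox{-}{\sf perm}(G)=\sum_{\sigma\in S_n}w(1,\sigma(1))\cdots w(n,\sigma(n))$ and ${\sf C}\mbox{-}{\sf det}(G)=\sum_{\sigma\in S_n}{\rm sgn}(\sigma)w(1,\sigma(1))\cdots w(n,\sigma(n))$, products taken in this order. ${\sf C}\mbox{-}{\sf perm}$ (resp. ${\sf C}\mbox{-}{\sf det}$) is the problem of computing this value for a given weighted digraph, and ${\sf planar}\mbox{-}{\sf C}\mbox{-}{\sf perm}$ (resp. ${\sf planar}\mbox{-}{\sf C}\mbox{-}{\sf det}$) is the same problem restricted to planar weighted digraphs. $\le_m^p$ denotes a polynomial-time many-one reduction: a polynomial-time map sending $G$ to a planar weighted digraph $G'$ with the same Cayley permanent (resp. determinant). *)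

(* Defs.v *)
From mathcomp Require Import all_boot all_order all_algebra all_fingroup.
From mathcomp Require Import all_classical all_reals all_analysis.
Import Order.TTheory GRing.Theory Num.Theory numFieldNormedType.Exports.

Set Implicit Arguments.
Unset Strict Implicit.
Unset Printing Implicit Defensive.

Local Open Scope classical_set_scope.
Local Open Scope ring_scope.

(* Products over ['I_n] are taken in increasing order of the index, so the
   factors appear row by row: [A 0 (s 0) * A 1 (s 1) * ...].  The Cayley
   determinant is the library's [\det], which is the same signed sum and is
   defined over any ring. *)
Definition cayley_perm (R : pzRingType) (n : nat) (A : 'M[R]_n) : R :=
  \sum_(s : 'S_n) \prod_(i < n) A i (s i).

Section Planarity.
Variable K : realType.

Definition simple_arc (g : K -> K * K) (x y : K * K) : Prop :=
  [/\ {within `[0, 1]%classic, continuous g}, g 0 = x, g 1 = y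
    & {in `[0, 1] &, injective g}].

(* [edge] is read as a set of unordered pairs, each listed once as [i < j]. *)
Definition planar_graph (n : nat) (edge : rel 'I_n) : Prop :=
  let e (i j : 'I_n) := ((i < j)%N && edge i j) in
  exists (p : 'I_n -> K * K) (g : 'I_n -> 'I_n -> K -> K * K),
  [/\ injective p,
      forall i j, e i j -> simple_arc (g i j) (p i) (p j),
      forall i j k (t : K), e i j -> 0 < t < 1 -> g i j t <> p k
    & forall i j k l (s t : K), e i j -> e k l -> (i, j) <> (k, l) ->
        0 < s < 1 -> 0 < t < 1 -> g i j s <> g k l t].

(* A digraph is planar when its underlying undirected graph is; loops and
   antiparallel pairs of edges do not matter for planarity. *)
Definition planar_digraph (R : pzRingType) (n : nat) (A : 'M[R]_n) : Prop :=
  planar_graph (fun i j => (A i j != 0) || (A j i != 0)).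

End Planarity.

(* Words are written over two bits and the separator [None]; a tape cell is
   blank ([None]) or holds a letter. *)
Definition letter : Type := option bool.
Definition cell : Type := option letter.

Variant move : Type := Left | Stay | Right.

(* [(l, r)] : the head scans the first cell of [r], and [l] lists the cells to
   its left, nearest first.  All cells not listed are blank. *)
Definition tape : Type := (seq cell * seq cell)%type.

Definition scan (t : tape) : cell := head None t.2.

Definition write_move (a : cell * move) (t : tape) : tape :=
  let r := a.1 :: behead t.2 in
  match a.2 with
  | Left => (behead t.1, head None t.1 :: r)
  | Stay => (t.1, r)
  | Right => (a.1 :: t.1, behead t.2)
  end.

Record machine : Type := Machine {
  extra_tapes : nat;
  state : finType;
  start : state;
  halting : pred state;
  delta : state -> {ffun 'I_extra_tapes.+1 -> cell} ->
          state * ('I_extra_tapes.+1 -> cell * move)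
}.

Section Run.
Variable M : machine.

Definition config : Type :=
  (state M * {ffun 'I_(extra_tapes M).+1 -> tape})%type.

Definition step (c : config) : config :=
  if halting c.1 then c else
  let: (q, a) := delta c.1 [ffun i => scan (c.2 i)] in
  (q, [ffun i => write_move (a i) (c.2 i)]).

(* The input is on tape 0, with the head on its first letter. *)
Definition initial (x : seq letter) : config :=
  (start M, [ffun i => if i == ord0 then ([::], map Some x) else ([::], [::])]).

(* The output is on tape 0, from the head up to the first blank. *)
Definition output (c : config) : seq letter :=
  let r := (c.2 ord0).2 in pmap id (take (index None r) r).

Definition computes_in (time : nat) (x y : seq letter) : Prop :=
  let c := iter time step (initial x) in halting c.1 /\ output c = y.

End Run.

Definition polytime (T U : Type) (encT : T -> seq letter)
    (encU : U -> seq letter) (f : T -> U) : Prop :=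
  exists (M : machine) (p : {poly nat}), forall x : T,
  exists2 time : nat, (time <= p.[size (encT x)])%N
    & computes_in M time (encT x) (encU (f x)).

(* As an input to a machine, a weighted digraph carries codes of its weights;
   it is written as its order in unary followed by its weight matrix row by
   row. *)
Record coded_digraph : Type := CodedDigraph {
  dg_order : nat;
  dg_weight : 'M[seq bool]_dg_order
}.

Definition encode (G : coded_digraph) : seq letter :=
  nseq (dg_order G) (Some true) ++ None ::
  flatten [seq rcons (map Some (dg_weight G i j)) None
          | i <- enum 'I_(dg_order G), j <- enum 'I_(dg_order G)].

(* An algebra together with a way of denoting elements by binary words.  Only
   the words denoting the constants 0, 1, -1 are prescribed; [value] is
   otherwise arbitrary, and need be neither injective, surjective nor
   computable (words that are not meant as codes may be given any value). *)
Record coded_algebra (c0 c1 cN1 : seq bool) : Type := CodedAlgebra {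
  algebra :> pzRingType;
  value : seq bool -> algebra;
  value0 : value c0 = 0;
  value1 : value c1 = 1;
  valueN1 : value cN1 = -1
}.

Section Problems.
Variables c0 c1 cN1 : seq bool.
Local Notation coded_algebra := (coded_algebra c0 c1 cN1).

Definition weight_mx (A : coded_algebra) (G : coded_digraph) :
  'M[A]_(dg_order G) := map_mx (value A) (dg_weight G).

Record problem : Type := Problem {
  is_instance : coded_algebra -> coded_digraph -> Prop;
  answer : forall A : coded_algebra, coded_digraph -> A
}.

(* The map is computed by one machine on the coded digraphs and must be correct
   over every algebra, whatever the codes stand for. *)
Definition many_one_reducible (P Q : problem) : Prop :=
  exists2 f : coded_digraph -> coded_digraph,
    polytime encode encode f
  & forall (A : coded_algebra) (G : coded_digraph), is_instance P A G ->
      is_instance Q A (f G) /\ answer Q A (f G) = answer P A G.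

Definition planar_restriction (K : realType) (P : problem) : problem :=
  {| is_instance A G := is_instance P A G /\ planar_digraph K (weight_mx A G);
     answer := @answer P |}.

Definition C_perm : problem :=
  {| is_instance _ _ := True; answer A G := cayley_perm (weight_mx A G) |}.

Definition C_det : problem :=
  {| is_instance _ _ := True; answer A G := \det (weight_mx A G) |}.

End Problems.

(* Main.v *)
(* The row wire of row i runs through a grid from a terminal s_i to the right and
   turns with weight A i j into the column wire of column j, which ends in the
   terminal s_j.  Where the row wire passes a column wire a planar gadget with
   weights 1, -1 and e is put, e = 1 for the permanent and e = -1 for the
   determinant.  A vertex with two ingoing and two outgoing wires, corrected by
   two edges of weight -1, lets two wires cross at the price of a factor -e when
   both are in use; a second vertex of the same kind, placed where the two wires
   run antiparallel, yields this factor again and removes it.  Eliminating the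
   cells in row-major order leaves a digraph on the s_i with weights A i j.

   Every weight A i j leaves its own vertex and these vertices are numbered
   row by row, so all products are taken in the order of the rows of A.  The
   identity to be proved is therefore one between the coefficients of ordered
   monomials, and these coefficients can be compared over the integers. *)
Require Import Defs.
From HB Require Import structures.
From mathcomp Require Import all_boot all_order all_algebra all_fingroup.
From mathcomp Require Import all_classical all_reals all_analysis.
From mathcomp Require Import ring lra zify.
Import Order.TTheory GRing.Theory Num.Theory numFieldNormedType.Exports.

Set Implicit Arguments.
Unset Strict Implicit.
Unset Printing Implicit Defensive.

(** * The planar weighted digraph *)

(** A cell vertex off the wires keeps a loop of weight [e], and a vertex inserted into a cycle
    changes the sign by [e] too; so it counts [e] whether used or not, and the length of a wire is
    irrelevant. Nine vertices give [e] per cell, the edges leaving the terminals give one more [e]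
    each, and [e ^+ (n * n + n)] is 1. At a vertex shared by two wires the edges of weight -1 cancel
    the wrong exits of a single wire. With both wires in use only wrong exits survive, counted 1 - 2
    = -1 times, and exchanging two ends costs [e]; hence [-e]. In the drawing the wires cross at
    vertex 1 but only touch at vertex 5, so the second factor does not undo the crossing. Instead of
    following cycles, the rows around a cell are written over nine unit rows and four undetermined
    rows, and a Laplace expansion of this fixed table is evaluated for both values of [e].
    Polynomial time is shown for a multitape machine. In blocks of nine weights the new matrix is
    constant up to position, except for one block per cell; these follow the order of the input
    words, so one pass over the input suffices. *)

Variant weight : Type := W0 | W1 | WN | WE | WG.

Definition weight_eqb (w w' : weight) : bool :=
  match w, w' with W0, W0 | W1, W1 | WN, WN | WE, WE | WG, WG => true | _, _ => false end.

Lemma weight_eqP : Equality.axiom weight_eqb.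
Proof. by case=> [] []; constructor. Qed.

HB.instance Definition _ := hasDecEq.Build weight weight_eqP.

(** The row wire is 7, 1, 4, 5, 6 and the column wire 8, 5, 3, 1, 2; the turn is 7, 0, 2, and its
    first edge has the input weight [WG]. The entries [WN] bypass vertex 1 (from 7 to 2 and from 3
    to 4) and vertex 5 (from 8 to 6 and from 4 to 3). *)
Definition inner : seq (seq weight) :=
  [:: [:: WE; W0; W1; W0; W0; W0; W0; W0; W0];
      [:: W0; WE; W1; W0; W1; W0; W0; W0; W0];
      [:: W0; W0; WE; W0; W0; W0; W0; W0; W0];
      [:: W0; W1; W0; WE; WN; W0; W0; W0; W0];
      [:: W0; W0; W0; WN; WE; W1; W0; W0; W0];
      [:: W0; W0; W0; W1; W0; WE; W1; W0; W0];
      [:: W0; W0; W0; W0; W0; W0; WE; W0; W0];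
      [:: WG; W1; WN; W0; W0; W0; W0; WE; W0];
      [:: W0; W0; W0; W0; W0; W1; WN; W0; WE]].

(* Grid row 0 contains the terminals [(0, j, 8)]; its other vertices are isolated
   and have a loop of weight 1.  Column wires run towards row 0. *)
Definition symbol (i j k i' j' k' : nat) : weight :=
  if i is i0.+1 then
    if (i' == i) && (j' == j) then nth W0 (nth [::] inner k) k'
    else if [&& i' == i, j' == j.+1, k == 6 & k' == 7] then W1
    else if [&& i' == i0, j' == j, k == 2 & k' == 8] then W1 else W0
  else if k == 8 then if [&& i' == j.+1, j' == 0 & k' == 7]%N then WE else W0
  else if [&& i' == 0, j' == j & k' == k]%N then W1 else W0.

(* The rows are those of the vertices of a cell, of the terminal that feeds its
   row wire and of the vertex that feeds its column wire.  The columns are the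
   vertices of the cell, the remainders of the last two rows, the target of the
   column wire and that of the row wire. *)

Definition planar_order (n : nat) : nat := n.+1 * n * 9.

Definition index_symbol (n u v : nat) : weight :=
  symbol (u %/ 9 %/ n) (u %/ 9 %% n) (u %% 9) (v %/ 9 %/ n) (v %/ 9 %% n) (v %% 9).

(** * A stack language and its compilation to multitape machines *)

Definition store : Type := seq (seq letter).

Definition top_of (st : store) (x : nat) : option letter := ohead (nth [::] st x).

Inductive prog : Type :=
| Skip
| Push of nat & letter
| Pop of nat
| Seq of prog & prog
| If of nat & (option letter -> bool) & prog & prog
| While of nat & (option letter -> bool) & prog.

(** The cost is the exact number of machine steps: a push takes two because a machine writes before
    it moves, and every test takes one. *)
Inductive exec : prog -> store -> nat -> store -> Prop :=
| exec_skip st : exec Skip st 1 st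
| exec_push x a st : exec (Push x a) st 2 (set_nth [::] st x (a :: nth [::] st x))
| exec_pop x st : exec (Pop x) st 1 (set_nth [::] st x (behead (nth [::] st x)))
| exec_seq p q st m st1 n st2 : exec p st m st1 -> exec q st1 n st2 ->
    exec (Seq p q) st (m + n) st2
| exec_if x (f : option letter -> bool) p q st n st1 : exec (if f (top_of st x) then p else q) st n st1 ->
    exec (If x f p q) st n.+1 st1
| exec_while0 x (f : option letter -> bool) p st : ~~ f (top_of st x) -> exec (While x f p) st 1 st
| exec_while x (f : option letter -> bool) p st m st1 n st2 : f (top_of st x) -> exec p st m st1 ->
    exec (While x f p) st1 n st2 -> exec (While x f p) st (m + n).+1 st2.

Fixpoint stacks_below (k : nat) (p : prog) : bool :=
  match p with
  | Skip => true
  | Push x _ | Pop x => x < k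
  | Seq p q => stacks_below k p && stacks_below k q
  | If x _ p q => [&& x < k, stacks_below k p & stacks_below k q]
  | While x _ p => (x < k) && stacks_below k p
  end.

(** One state per machine step: a push has two, and the extra element in [If] and [While] is the
    state in which the test is made. *)
Fixpoint point (p : prog) : finType :=
  match p with
  | Skip | Pop _ => unit
  | Push _ _ => bool
  | Seq p q => (point p + point q)%type
  | If _ _ p q => option (point p + point q)%type
  | While _ _ p => option (point p)
  end.

Fixpoint entry (p : prog) : point p :=
  match p return point p with
  | Skip | Pop _ => tt
  | Push _ _ => false
  | Seq p q => inl (entry p)
  | If _ _ p q => None
  | While _ _ p => None
  end.

Definition action : Type := nat -> cell * move.

Definition stay (r : nat -> cell) : action := fun y => (r y, Stay).

Definition act_on (x : nat) (a : cell * move) (r : nat -> cell) : action :=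
  fun y => if y == x then a else (r y, Stay).

(* The control point that follows, [None] being the exit, and the action taken. *)
Fixpoint transition (p : prog) : point p -> (nat -> cell) -> option (point p) * action :=
  match p return point p -> (nat -> cell) -> option (point p) * action with
  | Skip => fun _ r => (None, stay r)
  | Push x a => fun b r =>
      if b then (None, act_on x (Some a, Stay) r) else (Some true, act_on x (r x, Left) r)
  | Pop x => fun _ r => (None, act_on x (None, Right) r)
  | Seq p q => fun s r =>
      match s with
      | inl s => let: (s', a) := transition s r in
                 (Some (if s' is Some s' then inl s' else inr (entry q)), a)
      | inr s => let: (s', a) := transition s r in (omap inr s', a)
      end
  | If x f p q => fun s r =>
      match s with
      | None => (Some (Some (if f (r x) then inl (entry p) else inr (entry q))), stay r)
      | Some (inl s) => let: (s', a) := transition s r in (omap (Some \o inl) s', a)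
      | Some (inr s) => let: (s', a) := transition s r in (omap (Some \o inr) s', a)
      end
  | While x f p => fun s r =>
      match s with
      | None => (if f (r x) then Some (Some (entry p)) else None, stay r)
      | Some s => let: (s', a) := transition s r in (Some s', a)
      end
  end.

(** * Simulation of stack programs by machine steps *)

Section Compile.
Variable k : nat.
Local Notation tapes := {ffun 'I_k.+1 -> tape}.

Definition scans (tp : tapes) (x : nat) : cell := scan (tp (inord x)).

Definition perform (a : action) (tp : tapes) : tapes := [ffun i : 'I_k.+1 => write_move (a i) (tp i)].

Definition advance (p : prog) (s : point p) (tp : tapes) : option (point p) * tapes :=
  let: (s', a) := transition s (scans tp) in (s', perform a tp).

Inductive reach (p : prog) : point p -> tapes -> nat -> tapes -> Prop :=
| reach_exit s tp tp' : advance s tp = (None, tp') -> reach s tp 1 tp'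
| reach_next s tp s1 tp1 n tp' : advance s tp = (Some s1, tp1) -> reach s1 tp1 n tp' ->
    reach s tp n.+1 tp'.

Lemma reach_seq2 p q (s : point q) tp n tp' : reach s tp n tp' ->
  reach (p := Seq p q) (inr s) tp n tp'.
Proof.
elim=> {s tp n tp'} [s tp tp' E | s tp s1 tp1 n tp' E _ IH].
  by apply: reach_exit; move: E; rewrite /advance /=; case: transition => [[?|] ?] //= [->].
by apply: reach_next IH; move: E; rewrite /advance /=; case: transition => [[?|] ?] //= [-> ->].
Qed.

Lemma reach_seq p q (s : point p) tp m tp1 n tp2 : reach s tp m tp1 ->
  reach (entry q) tp1 n tp2 -> reach (p := Seq p q) (inl s) tp (m + n) tp2.
Proof.
move=> H Hq; elim: H Hq => {s tp m tp1} [s tp tp' E | s tp s1 tp1 m tp' E _ IH] Hq.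
  apply: reach_next (reach_seq2 p Hq).
  by move: E; rewrite /advance /=; case: transition => [[?|] ?] // [->].
rewrite addSn; apply: reach_next (IH Hq).
by move: E; rewrite /advance /=; case: transition => [[?|] ?] //= [-> ->].
Qed.

Lemma reach_if x f p q (b : bool) tp n tp' :
  (if b then reach (entry p) tp n tp' else reach (entry q) tp n tp') ->
  reach (p := If x f p q) (Some (if b then inl (entry p) else inr (entry q))) tp n tp'.
Proof.
case: b.
  move: (entry p) => s; elim=> {s tp n tp'} [s tp tp' E | s tp s1 tp1 n tp' E _ IH].
    by apply: reach_exit; move: E; rewrite /advance /=; case: transition => [[?|] ?] //= [->].
  by apply: reach_next IH; move: E; rewrite /advance /=; case: transition => [[?|] ?] //= [-> ->].
move: (entry q) => s; elim=> {s tp n tp'} [s tp tp' E | s tp s1 tp1 n tp' E _ IH].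
  by apply: reach_exit; move: E; rewrite /advance /=; case: transition => [[?|] ?] //= [->].
by apply: reach_next IH; move: E; rewrite /advance /=; case: transition => [[?|] ?] //= [-> ->].
Qed.

Lemma reach_while x f p (s : point p) tp m tp1 n tp2 : reach s tp m tp1 ->
  reach (p := While x f p) None tp1 n tp2 ->
  reach (p := While x f p) (Some s) tp (m + n) tp2.
Proof.
move=> H Hw; elim: H Hw => {s tp m tp1} [s tp tp' E | s tp s1 tp1 m tp' E _ IH] Hw.
  apply: reach_next Hw.
  by move: E; rewrite /advance /=; case: transition => [[?|] ?] // [->].
rewrite addSn; apply: reach_next (IH Hw).
by move: E; rewrite /advance /=; case: transition => [[?|] ?] //= [-> ->].
Qed.

(* A stack lies to the right of the head, its top under the head, and all other
   cells are blank. *)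
Definition holds_stack (t : tape) (s : seq letter) : Prop :=
  all (pred1 None) t.1 /\ exists m, t.2 = map Some s ++ nseq m None.

Definition holds_store (tp : tapes) (st : store) : Prop :=
  forall i : 'I_k.+1, holds_stack (tp i) (nth [::] st i).

Lemma scan_stack t s : holds_stack t s -> scan t = ohead s.
Proof. by case: t s => l r [|a s] [_ [m /= ->]] //; case: m. Qed.

Lemma stay_stack t s : holds_stack t s -> holds_stack (write_move (scan t, Stay) t) s.
Proof.
case: t => l r [/= Hl [m E]]; split=> //=; rewrite /scan /= E.
(* On an empty stack the head writes a blank, which may lengthen the listed part of the tape by one
   cell; the padding [m] absorbs this. *)
by case: s {E} => [|a s] /=; [case: m => [|m]; [exists 1 | exists m.+1] | exists m].
Qed.

Lemma push_stack t s a : holds_stack t s ->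
  holds_stack (write_move (Some a, Stay) (write_move (scan t, Left) t)) (a :: s).
Proof.
case: t => l r [/= Hl [m E]]; split=> /=; first by case: l Hl => //= b l /andP[].
rewrite /scan /= E.
by case: s {E} => [|b s] /=; [case: m => [|m]; [exists 1 | exists m.+1] | exists m].
Qed.

Lemma pop_stack t s : holds_stack t s ->
  holds_stack (write_move (None, Right) t) (behead s).
Proof.
case: t => l r [/= Hl [m E]]; split=> //=; rewrite E.
by case: s {E} => [|b s] /=; [exists m.-1; case: m | exists m].
Qed.

Lemma stay_store tp st : holds_store tp st -> holds_store (perform (stay (scans tp)) tp) st.
Proof.
by move=> H i; rewrite ffunE /stay /scans inord_val; apply: stay_stack.
Qed.

Lemma scans_store tp st x : x < k.+1 -> holds_store tp st -> scans tp x = top_of st x.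
Proof. by move=> xk H; rewrite /scans (scan_stack (H (inord x))) inordK. Qed.

(** Induction on the execution, gluing runs of subprograms. The store does not determine the tapes,
    because blanks pile up around the stacks; hence an invariant between the two and an existential
    for the final tapes. *)
Lemma exec_reach p st n st' tp : exec p st n st' -> stacks_below k.+1 p ->
  holds_store tp st -> exists2 tp', reach (entry p) tp n tp' & holds_store tp' st'.
Proof.
move=> H; elim: H tp => {p st n st'} [st|x a st|x st|p q st m st1 n st2 _ IHp _ IHq
  |x f p q st n st1 _ IH|x f p st fx|x f p st m st1 n st2 fx _ IHp _ IHw] tp /=.
- move=> _ H; exists (perform (stay (scans tp)) tp); last exact: stay_store.
  exact: reach_exit.
- move=> xk H; set tp1 := perform (act_on x (scans tp x, Left) (scans tp)) tp.
  exists (perform (act_on x (Some a, Stay) (scans tp1)) tp1).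
    by apply: (@reach_next (Push x a) false tp true tp1 1 _ erefl); apply: reach_exit.
  move=> i; rewrite nth_set_nth /=.
  have tp1E : tp1 i = write_move (if i == x :> nat then (scan (tp i), Left) else (scan (tp i), Stay)) (tp i).
    rewrite /tp1 ffunE /act_on; case: eqP => [ix|_]; last by rewrite /scans inord_val.
    by rewrite -ix /scans inord_val.
  rewrite ffunE /act_on /scans inord_val tp1E; case: eqP => [ix|_].
    by rewrite -ix; apply: push_stack.
  by do 2!apply: stay_stack.
- move=> xk H; exists (perform (act_on x (None, Right) (scans tp)) tp); first exact: reach_exit.
  move=> i; rewrite nth_set_nth /= !ffunE /act_on; case: eqP => [ix|_].
    by rewrite -ix; apply: pop_stack.
  by rewrite /scans inord_val; apply: stay_stack.
- move=> /andP[wp wq] H; have [tp1 r1 H1] := IHp _ wp H; have [tp2 r2 H2] := IHq _ wq H1.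
  by exists tp2 => //; apply: reach_seq r1 r2.
- move=> /and3P[xk wp wq] H; have H0 := stay_store H.
  have [|tp1 r1 H1] := IH _ _ H0; first by case: ifP.
  exists tp1 => //; apply: reach_next; first by rewrite /advance /= (scans_store xk H).
  by apply: reach_if; move: r1; case: (f _).
- move=> /andP[xk wp] H; exists (perform (stay (scans tp)) tp); last exact: stay_store.
  by apply: reach_exit; rewrite /advance /= (scans_store xk H) (negbTE fx).
move=> /andP[xk wp] H; have H0 := stay_store H.
have [tp1 r1 H1] := IHp _ wp H0; have [|tp2 r2 H2] := IHw _ _ H1; first by rewrite /= xk.
exists tp2 => //; apply: reach_next; first by rewrite /advance /= (scans_store xk H) fx.
exact: reach_while r1 r2.
Qed.

Definition machine_of (p : prog) : machine :=
  @Machine k (option (point p)) (Some (entry p)) (pred1 None)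
    (fun s r => if s is Some s then
       let: (s', a) := transition s (fun x => r (inord x)) in (s', fun i : 'I_k.+1 => a (nat_of_ord i))
     else (None, fun i => (r i, Stay))).

Lemma reach_iter p (s : point p) tp n tp' : reach s tp n tp' ->
  iter n (@step (machine_of p)) (Some s, tp) = (None, tp').
Proof.
have st1 (s0 : point p) tp0 : @step (machine_of p) (Some s0, tp0) = advance s0 tp0.
  rewrite /step /advance /=.
  have -> : (fun x : nat => [ffun i => scan (tp0 i)] (inord x)) = scans tp0.
    by apply: boolp.funext => x; rewrite ffunE.
  by case: transition.
by elim=> {s tp n tp'} [s tp tp' E | s tp s1 tp1 n tp' E _ IH]; rewrite iterSr st1 E //= ?IH.
Qed.

End Compile.

Lemma polytime_prog (T U : Type) (encT : T -> seq letter) (encU : U -> seq letter)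
    (f : T -> U) (k : nat) (p : prog) (b : {poly nat}) :
  stacks_below k.+1 p ->
  (forall x, exists n st, [/\ n <= b.[size (encT x)]%R, exec p (encT x :: nseq k [::]) n st
    & nth [::] st 0 = encU (f x)]) ->
  polytime encT encU f.
Proof.
move=> wp H; exists (machine_of k p), b => x.
have [n [st [nb ex out]]] := H x; exists n => //.
pose tp0 := (initial (machine_of k p) (encT x)).2.
have H0 : holds_store tp0 (encT x :: nseq k [::]).
  move=> i; rewrite /tp0 /= ffunE -val_eqE /=; case: i => [[|i] ilt] /=.
    by split=> //; exists 0; rewrite cats0.
  by rewrite nth_nseq if_same; split=> //; exists 0.
have [tp' /reach_iter it H'] := exec_reach ex wp H0.
rewrite /computes_in; have -> : initial (machine_of k p) (encT x) = (Some (entry p), tp0) by [].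
rewrite it; split=> //; rewrite /output /=.
have [_ [m ->]] := H' ord0; rewrite -out; move: (nth _ _ _) => s.
have -> : index None (map Some s ++ nseq m None) = size s.
  by elim: s => [|a s /= ->] //=; case: m.
rewrite -(size_map Some s) take_size_cat //.
by elim: s => //= a s ->.
Qed.

(** * A polynomial-time program for the reduction *)

Definition cats (T : Type) (F : nat -> seq T) (a m : nat) : seq T := flatten [seq F x | x <- iota a m].

Section Cats.
Variable T : Type.
Implicit Types F G : nat -> seq T.

Lemma catsD F a m p : cats F a (m + p) = cats F a m ++ cats F (a + m) p.
Proof. by rewrite /cats iotaD map_cat flatten_cat. Qed.

Lemma catsS F a m : cats F a m.+1 = F a ++ cats F a.+1 m.
Proof. by []. Qed.

Lemma cats_single F a : cats F a 1 = F a.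
Proof. by rewrite catsS cats0. Qed.

Lemma eq_cats F G a m : (forall x, a <= x < a + m -> F x = G x) -> cats F a m = cats G a m.
Proof. by move=> H; congr flatten; apply/eq_in_map => x; rewrite mem_iota => /H. Qed.

Lemma cats_const F a m s : (forall x, a <= x < a + m -> F x = s) -> cats F a m = flatten (nseq m s).
Proof.
move=> /eq_cats ->; rewrite /cats; elim: m a => //= m IH a.
by rewrite IH.
Qed.

Lemma cats_add F a m : cats F a m = cats (fun x => F (a + x)) 0 m.
Proof. by rewrite /cats -{1}[a]addn0 iotaDl -map_comp. Qed.

Lemma cats_mul F m p : cats F 0 (m * p) = cats (fun x => cats (fun y => F (x * p + y)) 0 p) 0 m.
Proof.
elim: m => // m IH; rewrite mulSn addnC catsD IH add0n -[m.+1]addn1 catsD cats_single add0n.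
by congr (_ ++ _); rewrite cats_add.
Qed.

End Cats.

Definition ones (m : nat) : seq letter := nseq m (Some true).

(* Stack 0 is the input, stack 1 the output, held in reverse, and stack [x + 2]
   contains the counter [x] in unary. *)
Definition cstore (c : seq nat) (io o : seq letter) : store := io :: o :: map ones c.

Lemma nth_ones c x : nth [::] (map ones c) x = ones (nth 0 c x).
Proof. by elim: c x => [|a c IH] [|x] //=. Qed.

Lemma set_nth_ones c x m : set_nth [::] (map ones c) x (ones m) = map ones (set_nth 0 c x m).
Proof.
elim: c x => [|a c IH] [|x] //=; last by rewrite IH.
by congr (_ :: _); elim: x => //= x ->.
Qed.

Definition runs (p : prog) (st : store) (b : nat) (st' : store) : Prop :=
  exists2 n, n <= b & exec p st n st'.

Lemma runs_seq p q st b st1 b' st2 : runs p st b st1 -> runs q st1 b' st2 ->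
  runs (Seq p q) st (b + b') st2.
Proof. by move=> [m mb H] [n nb H']; exists (m + n); [exact: leq_add | exact: exec_seq H H']. Qed.

Lemma runs_leq p st b b' st' : runs p st b st' -> b <= b' -> runs p st b' st'.
Proof. by move=> [n nb H] bb'; exists n => //; apply: leq_trans bb'. Qed.

Lemma runs_push_counter c io o x : runs (Push x.+2 (Some true)) (cstore c io o) 2
  (cstore (set_nth 0 c x (nth 0 c x).+1) io o).
Proof.
exists 2 => //; rewrite /cstore -set_nth_ones -[ones _.+1]/(Some true :: ones _) -nth_ones.
exact: (exec_push x.+2 (Some true) (cstore c io o)).
Qed.

Lemma runs_pop_counter c io o x : runs (Pop x.+2) (cstore c io o) 1
  (cstore (set_nth 0 c x (nth 0 c x).-1) io o).
Proof.
exists 1 => //; rewrite /cstore -set_nth_ones.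
have -> : ones (nth 0 c x).-1 = behead (nth [::] (map ones c) x).
  by rewrite nth_ones; case: nth.
exact: (exec_pop x.+2 (cstore c io o)).
Qed.

Definition nonempty (a : option letter) : bool := isSome a.

Lemma top_counter c io o x : nonempty (top_of (cstore c io o) x.+2) = (0 < nth 0 c x).
Proof. by rewrite /top_of /= nth_ones; case: nth. Qed.

Lemma runs_while0 x (f : option letter -> bool) p st : ~~ f (top_of st x) -> runs (While x f p) st 1 st.
Proof. by move=> H; exists 1 => //; apply: exec_while0. Qed.

Lemma runs_while x (f : option letter -> bool) p st b st1 b' st2 : f (top_of st x) -> runs p st b st1 ->
  runs (While x f p) st1 b' st2 -> runs (While x f p) st (b + b').+1 st2.
Proof.
move=> fx [m mb H] [n nb H']; exists (m + n).+1; first by rewrite ltnS leq_add.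
exact: exec_while fx H H'.
Qed.

Lemma runs_if x (f : option letter -> bool) p q st b st1 : runs (if f (top_of st x) then p else q) st b st1 ->
  runs (If x f p q) st b.+1 st1.
Proof. by move=> [n nb H]; exists n.+1 => //; apply: exec_if. Qed.

(** The counters have to return to their initial values, so that such programs can be sequenced and
    nested freely; the earlier output [o] is arbitrary for the same reason. *)
Definition emits (p : prog) (c : seq nat) (io s io' : seq letter) (b : nat) : Prop :=
  forall o, runs p (cstore c io o) b (cstore c io' (rev s ++ o)).

Lemma emits_leq p c io s io' b b' : emits p c io s io' b -> b <= b' -> emits p c io s io' b'.
Proof. by move=> H bb' o; apply: runs_leq (H o) bb'. Qed.

Lemma emits_seq p q c io s io1 s' io2 b b' : emits p c io s io1 b -> emits q c io1 s' io2 b' ->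
  emits (Seq p q) c io (s ++ s') io2 (b + b').
Proof. by move=> H H' o; rewrite rev_cat -catA; apply: runs_seq (H o) (H' _). Qed.

Lemma emits_skip c io : emits Skip c io [::] io 1.
Proof. by move=> o; exists 1 => //; apply: exec_skip. Qed.

Lemma emits_push c io a : emits (Push 1 a) c io [:: a] io 2.
Proof. by move=> o; exists 2 => //; apply: (exec_push 1 a (cstore c io o)). Qed.

Definition seqs (ps : seq prog) : prog := foldr Seq Skip ps.

Lemma emits_seqs (P : nat -> prog) c (io s : nat -> seq letter) b a m :
  (forall k, a <= k < a + m -> emits (P k) c (io k) (s k) (io k.+1) b) ->
  emits (seqs (map P (iota a m))) c (io a) (cats s a m) (io (a + m)) (m * b).+1.
Proof.
elim: m a => [|m IH] a H; first by rewrite addn0; apply: emits_skip.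
rewrite catsS mulSn -addnS addnS -addSn; apply: emits_seq.
  by apply: H; rewrite leqnn addnS ltnS leq_addr.
by apply: IH => k /andP[ak km]; apply: H; rewrite (ltnW ak) addnS.
Qed.

Definition emit (s : seq letter) : prog := seqs (map (Push 1) s).

Lemma emits_emit c io s : emits (emit s) c io s io (2 * size s).+1.
Proof.
elim: s => [|a s IH]; first exact: emits_skip.
by rewrite -cat1s mulnS -addnS; apply: emits_seq IH; apply: emits_push.
Qed.

(** Counting down [x] fills [t], and the second loop moves everything back. During a round [t] holds
    the number of rounds done and [x] the number of rounds still to come, so the body knows its
    position from both sides. *)
Definition For (x t : nat) (body : prog) : prog :=
  Seq (While x.+2 nonempty (Seq (Pop x.+2) (Seq body (Push t.+2 (Some true)))))
      (While t.+2 nonempty (Seq (Pop t.+2) (Push x.+2 (Some true)))).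

(** [c a a'] is the list of counters with [a] in [x] and [a'] in [t]; for explicit lists the four
    equations hold by computation. A round costs [b + 4] on the way down and 4 on the way back, and
    the two failing tests give the final 2. *)
Lemma emits_for (c : nat -> nat -> seq nat) (x t : nat) (body : prog)
    (io s : nat -> seq letter) (b m : nat) :
  (forall a a', nth 0 (c a a') x = a) -> (forall a a', nth 0 (c a a') t = a') ->
  (forall a a' d, set_nth 0 (c a a') x d = c d a') ->
  (forall a a' d, set_nth 0 (c a a') t d = c a d) ->
  (forall j, j < m -> emits body (c (m - j.+1) j) (io j) (s j) (io j.+1) b) ->
  emits (For x t body) (c m 0) (io 0) (cats s 0 m) (io m) (m * (b + 8) + 2).
Proof.
move=> cx ct sx stt H o.
have up a : a <= m -> forall o,
    runs (While x.+2 nonempty (Seq (Pop x.+2) (Seq body (Push t.+2 (Some true)))))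
     (cstore (c a (m - a)) (io (m - a)) o) (a * (b + 4)).+1
     (cstore (c 0 m) (io m) (rev (cats s (m - a) a) ++ o)).
  elim: a => [|a IH] am o'.
    by rewrite !subn0; apply: runs_while0; rewrite top_counter cx.
  have [E E' lt] : [/\ m - a = (m - a.+1).+1, m - (m - a.+1).+1 = a & m - a.+1 < m] by split; lia.
  have := H _ lt; rewrite E' => /(_ o') Hb.
  have := runs_push_counter (c a (m - a.+1)) (io (m - a)) (rev (s (m - a.+1)) ++ o') t.
  rewrite ct stt -E => Hp.
  have := runs_pop_counter (c a.+1 (m - a.+1)) (io (m - a.+1)) o' x; rewrite cx sx /= => Hx.
  have -> : (a.+1 * (b + 4)).+1 = ((1 + (b + 2)) + (a * (b + 4)).+1).+1 by lia.
  apply: runs_while; first by rewrite top_counter cx.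
    by rewrite -E in Hb; apply: runs_seq Hx (runs_seq Hb Hp).
  rewrite catsS rev_cat -catA -E; apply: IH; exact: ltnW.
have down a : a <= m -> forall io' o',
    runs (While t.+2 nonempty (Seq (Pop t.+2) (Push x.+2 (Some true))))
      (cstore (c (m - a) a) io' o') (a * 4).+1 (cstore (c m 0) io' o').
  elim: a => [|a IH] am io' o'.
    by rewrite subn0; apply: runs_while0; rewrite top_counter ct.
  have -> : (a.+1 * 4).+1 = ((1 + 2) + (a * 4).+1).+1 by lia.
  apply: runs_while; first by rewrite top_counter ct.
    by apply: runs_seq; [exact: runs_pop_counter | exact: runs_push_counter].
  by rewrite ct stt /= cx sx subnSK //; apply: IH; exact: ltnW.
have -> : m * (b + 8) + 2 = (m * (b + 4)).+1 + (m * 4).+1 by lia.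
have := down m (leqnn m) (io m) (rev (cats s 0 m) ++ o); have := up m (leqnn m) o.
by rewrite subnn => U D; apply: runs_seq U D.
Qed.

(** Bounds the length of the output by the time spent on writing it, which makes the final reversal
    polynomial. *)
Lemma exec_size p st n st' x : exec p st n st' ->
  size (nth [::] st' x) <= size (nth [::] st x) + n.
Proof.
elim=> {p st n st'} [st|y a st|y st|p q st m st1 n st2 _ IH _ IH'
  |y f p q st n st1 _ IH|y f p st fx|y f p st m st1 n st2 fx _ IH _ IH'] /=; try lia.
- by rewrite nth_set_nth /=; case: eqP => [->|_] /=; lia.
- by rewrite nth_set_nth /=; case: eqP => [->|_] /=; rewrite ?size_behead; lia.
Qed.

Definition letters (w : seq bool) : seq letter := rcons (map Some w) None.

(** Up to translation only finitely many of these blocks are non-zero. Each is named by a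
    representative near the origin, such as [symbols 1 0 k 0 0], so that a fixed program can contain
    it as a constant. *)
Definition symbols (i j k i' j' : nat) : seq weight := [seq symbol i j k i' j' k' | k' <- iota 0 9].

(** * The blocks in the row of one vertex *)

Section SymbolRows.
Variables (i j k : nat).

Lemma symbols_row0 i' j' : i' <> i -> i' <> i.+1 -> symbols i.+1 j k i' j' = nseq 9 W0.
Proof.
move=> /eqP/negbTE E /eqP/negbTE E1; rewrite /symbols /symbol E E1.
by [].
Qed.

Lemma symbols_up j' : symbols i.+1 j k i j' = if j' == j then symbols 1 0 k 0 0 else nseq 9 W0.
Proof.
rewrite /symbols /symbol (ltn_eqF (ltnSn i)) eqxx /=.
by case: (j' == j).
Qed.

Lemma symbols_same : symbols i.+1 j k i.+1 j = symbols 1 0 k 1 0.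
Proof. by rewrite /symbols /symbol !eqxx. Qed.

Lemma symbols_right : symbols i.+1 j k i.+1 j.+1 = symbols 1 0 k 1 1.
Proof. by rewrite /symbols /symbol !eqxx (gtn_eqF (ltnSn j)) (gtn_eqF (ltnSn i)). Qed.

Lemma symbols_row j' : j' <> j -> j' <> j.+1 -> symbols i.+1 j k i.+1 j' = nseq 9 W0.
Proof.
move=> /eqP/negbTE E /eqP/negbTE E1; by rewrite /symbols /symbol E E1 (gtn_eqF (ltnSn i)) /= !andbF.
Qed.

Lemma symbols_top i' j' : k != 8 ->
  symbols 0 j k i' j' = if (i' == 0) && (j' == j) then symbols 0 0 k 0 0 else nseq 9 W0.
Proof.
move=> /negbTE k8; rewrite /symbols /symbol k8 /=.
by case: (i' == 0); case: (j' == j).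
Qed.

Lemma symbols_return i' j' :
  symbols 0 j 8 i' j' = if (i' == j.+1) && (j' == 0) then symbols 0 0 8 1 0 else nseq 9 W0.
Proof.
rewrite /symbols /symbol /=.
by case: (i' == j.+1); case: (j' == 0).
Qed.

End SymbolRows.

Section Reduction.
Variables c0 c1 cN1 cE : seq bool.

Definition weight_code (g : seq bool) (w : weight) : seq bool :=
  match w with W0 => c0 | W1 => c1 | WN => cN1 | WE => cE | WG => g end.

Definition block_letters (g : seq bool) (ws : seq weight) : seq letter :=
  flatten [seq letters (weight_code g w) | w <- ws].

Definition plain_letters : seq letter := block_letters [::] (nseq 9 W0).

Definition plain_row_letters (n : nat) : seq letter := flatten (nseq n plain_letters).

Definition row_letters (n : nat) (g : seq bool) (i j k : nat) : seq letter :=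
  cats (fun i' => cats (fun j' => block_letters g (symbols i j k i' j')) 0 n) 0 n.+1.

Lemma block_lettersW g ws : WG \notin ws -> block_letters g ws = block_letters [::] ws.
Proof.
elim: ws => //= w ws IH; rewrite inE negb_or => /andP[wG /IH E].
by rewrite /block_letters /= -!/(block_letters _ ws) E; case: w wG.
Qed.

Lemma plain_cats n g F : (forall j', j' < n -> F j' = nseq 9 W0) ->
  cats (fun j' => block_letters g (F j')) 0 n = plain_row_letters n.
Proof. by move=> H; apply: cats_const => x /= xn; rewrite H. Qed.

(** The text is cut at the non-zero blocks, so that every repetition is counted by one of [i], [j],
    [n - i.+1], [n - j.+1], the numbers that the counters hold, or by [n - j.+1] less one. The [if]
    drops the right neighbour in the last grid column. *)
Lemma grid_row_letters n g i j k : i < n -> j < n -> k < 9 ->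
  row_letters n g i.+1 j k =
  flatten (nseq i (plain_row_letters n)) ++ flatten (nseq j plain_letters) ++
  block_letters [::] (symbols 1 0 k 0 0) ++ flatten (nseq (n - j.+1) plain_letters) ++
  flatten (nseq j plain_letters) ++ block_letters g (symbols 1 0 k 1 0) ++
  (if n - j.+1 is j2.+1 then block_letters [::] (symbols 1 0 k 1 1) ++ flatten (nseq j2 plain_letters)
   else [::]) ++ flatten (nseq (n - i.+1) (plain_row_letters n)).
Proof.
move=> lin ljn k9; rewrite /row_letters.
have [noG noG'] : WG \notin symbols 1 0 k 0 0 /\ WG \notin symbols 1 0 k 1 1.
  by case: k k9 => [|[|[|[|[|[|[|[|[|]]]]]]]]].
have {1}-> : n.+1 = i + (1 + (1 + (n - i.+1))) by lia.
have En : n = j + (1 + (n - j.+1)) by lia.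
rewrite !catsD !cats_single !add0n !addn1.
rewrite (cats_const (s := plain_row_letters n)); last first.
  by move=> i' /= lt; apply: plain_cats => j' _; rewrite symbols_row0 //; lia.
rewrite [cats _ i.+2 _](cats_const (s := plain_row_letters n)); last first.
  by move=> i' /= lt; apply: plain_cats => j' _; rewrite symbols_row0 //; lia.
congr (_ ++ _); rewrite -!catA.
have up : cats (fun j' => block_letters g (symbols i.+1 j k i j')) 0 n =
   flatten (nseq j plain_letters) ++ block_letters [::] (symbols 1 0 k 0 0) ++
   flatten (nseq (n - j.+1) plain_letters).
  rewrite {1}En !catsD cats_single !add0n addn1; congr (_ ++ (_ ++ _)).
  - by apply: cats_const => j' /= lt; rewrite symbols_up ltn_eqF //.
  - by rewrite symbols_up eqxx block_lettersW.
  by apply: cats_const => j' /= /andP[lt _]; rewrite symbols_up gtn_eqF.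
have same : cats (fun j' => block_letters g (symbols i.+1 j k i.+1 j')) 0 n =
   flatten (nseq j plain_letters) ++ block_letters g (symbols 1 0 k 1 0) ++
   (if n - j.+1 is j2.+1 then block_letters [::] (symbols 1 0 k 1 1) ++ flatten (nseq j2 plain_letters)
   else [::]).
  rewrite {1}En !catsD cats_single !add0n addn1 symbols_same; congr (_ ++ (_ ++ _)).
    by apply: cats_const => j' /= lt; rewrite symbols_row //; lia.
  case: (n - j.+1) => // j2; rewrite catsS symbols_right; congr (_ ++ _).
    by rewrite block_lettersW.
  by apply: cats_const => j' /= /andP[lt _]; rewrite symbols_row //; lia.
by rewrite up same -!catA.
Qed.

Lemma top_row_letters n g j k : j < n -> k < 8 ->
  row_letters n g 0 j k =
  flatten (nseq j plain_letters) ++ block_letters [::] (symbols 0 0 k 0 0) ++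
  flatten (nseq (n - j.+1) plain_letters) ++ flatten (nseq n (plain_row_letters n)).
Proof.
move=> ljn k8; rewrite /row_letters catsS.
have k8' : k != 8 by rewrite ltn_eqF.
rewrite [cats _ 1 n](cats_const (s := plain_row_letters n)); last first.
  by move=> i' /andP[i'0 _]; apply: plain_cats => j' _; rewrite symbols_top // gtn_eqF.
transitivity ((flatten (nseq j plain_letters) ++ block_letters [::] (symbols 0 0 k 0 0) ++
  flatten (nseq (n - j.+1) plain_letters)) ++ flatten (nseq n (plain_row_letters n))); last first.
  by rewrite -catA -(catA (block_letters _ _)).
congr (_ ++ _); have {1}-> : n = j + (1 + (n - j.+1)) by lia.
rewrite !catsD cats_single !add0n addn1; congr (_ ++ (_ ++ _)).
- by apply: cats_const => j' /= lt; rewrite symbols_top // (ltn_eqF lt).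
- rewrite symbols_top // !eqxx block_lettersW //.
  by case: k k8 {k8'} => [|[|[|[|[|[|[|[|]]]]]]]].
by apply: cats_const => j' /= /andP[lt _]; rewrite symbols_top // (gtn_eqF lt).
Qed.

(** The [n - 1] zero blocks after the non-zero one are counted as [j] and [n - j.+1], since no
    counter holds [n - 1]. *)
Lemma return_row_letters n g j : j < n ->
  row_letters n g 0 j 8 =
  plain_row_letters n ++ flatten (nseq j (plain_row_letters n)) ++
  block_letters [::] (symbols 0 0 8 1 0) ++ flatten (nseq j plain_letters) ++
  flatten (nseq (n - j.+1) plain_letters) ++ flatten (nseq (n - j.+1) (plain_row_letters n)).
Proof.
move=> ljn; rewrite /row_letters catsS.
rewrite plain_cats; last by move=> j' _; rewrite symbols_return.
congr (_ ++ _).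
have En : n = j + (1 + (n - j.+1)) by lia.
rewrite [X in cats _ 1 X]En !catsD cats_single addn1 add1n.
rewrite (cats_const (s := plain_row_letters n)); last first.
  by move=> i' /andP[_ lt]; apply: plain_cats => j' _; rewrite symbols_return ltn_eqF // -add1n.
rewrite [cats _ j.+2 _](cats_const (s := plain_row_letters n)); last first.
  by move=> i' /andP[lt _]; apply: plain_cats => j' _; rewrite symbols_return gtn_eqF.
congr (_ ++ _).
transitivity ((block_letters [::] (symbols 0 0 8 1 0) ++ flatten (nseq j plain_letters) ++
  flatten (nseq (n - j.+1) plain_letters)) ++ flatten (nseq (n - j.+1) (plain_row_letters n))); last first.
  by rewrite -(catA (block_letters _ _)) -catA.
congr (_ ++ _); have {1}-> : n = (j + (n - j.+1)).+1 by lia.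
rewrite catsS symbols_return !eqxx block_lettersW //; congr (_ ++ _).
rewrite catsD; congr (_ ++ _); apply: cats_const => j' /= /andP[lt _];
  by rewrite symbols_return andbC (_ : (j' == 0) = false) //; lia.
Qed.

Definition block_time : nat := (2 * (9 * (size c0 + size c1 + size cN1 + size cE).+1)).+1.

Lemma size_block_letters ws :
  size (block_letters [::] ws) <= size ws * (size c0 + size c1 + size cN1 + size cE).+1.
Proof.
elim: ws => //= w ws IH; rewrite /block_letters /= size_cat mulSn leq_add //.
by rewrite /letters size_rcons size_map; case: w => //=; lia.
Qed.

Lemma emits_block c io ws : size ws <= 9 ->
  emits (emit (block_letters [::] ws)) c io (block_letters [::] ws) io block_time.
Proof.
move=> s9; apply: emits_leq (emits_emit _ _ _) _.
rewrite /block_time ltnS leq_mul2l /=; apply: leq_trans (size_block_letters ws) _.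
by rewrite leq_mul2r s9 orbT.
Qed.

Definition is_bit (a : option letter) : bool := if a is Some (Some _) then true else false.
Definition is_one (a : option letter) : bool := if a is Some (Some true) then true else false.
Definition is_separator (a : option letter) : bool := if a is Some None then true else false.

Definition copy_word : prog :=
  Seq (While 0 is_bit (If 0 is_one (Seq (Pop 0) (Push 1 (Some true)))
                                   (Seq (Pop 0) (Push 1 (Some false)))))
      (Seq (Pop 0) (Push 1 None)).

Lemma emits_pop_io c a io : emits (Pop 0) c (a :: io) [::] io 1.
Proof. by move=> o; exists 1 => //; apply: (exec_pop 0 (cstore c (a :: io) o)). Qed.

Lemma emits_copy_word c io w :
  emits copy_word c (letters w ++ io) (letters w) io (5 * size w + 4).
Proof.
have lw : letters w = map Some w ++ [:: None] by rewrite /letters -cats1.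
have -> : 5 * size w + 4 = (5 * size w).+1 + 3 by lia.
rewrite lw -catA /=.
apply: emits_seq; last first.
  exact: (emits_seq (emits_pop_io c None io) (emits_push _ _ _)).
elim: w {lw} => [|b w IH] o; first exact: runs_while0.
have -> : (5 * size (b :: w)).+1 = (4 + (5 * size w).+1).+1 by rewrite /=; lia.
apply: runs_while (_ : runs _ _ _ (cstore c (map Some w ++ None :: io) (Some b :: o))) _ => //.
  apply: runs_if; case: b => /=.
    exact: (emits_seq (emits_pop_io c (Some true) _) (emits_push c _ (Some true)) o).
  exact: (emits_seq (emits_pop_io c (Some false) _) (emits_push c _ (Some false)) o).
by rewrite /= rev_cons cat_rcons; apply: IH.
Qed.

Definition for_time (m b : nat) : nat := m * (b + 8) + 2.

Lemma emits_for_const (c : nat -> nat -> seq nat) (x t : nat) (body : prog)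
    (io s : seq letter) (b m M : nat) :
  (forall a a', nth 0 (c a a') x = a) -> (forall a a', nth 0 (c a a') t = a') ->
  (forall a a' d, set_nth 0 (c a a') x d = c d a') ->
  (forall a a' d, set_nth 0 (c a a') t d = c a d) ->
  (forall a a', emits body (c a a') io s io b) -> m <= M ->
  emits (For x t body) (c m 0) io (flatten (nseq m s)) io (for_time M b).
Proof.
move=> cx ct sx stt H mM; rewrite -(@cats_const _ (fun=> s) 0 m) //.
apply: emits_leq (_ : emits _ _ _ _ _ (m * (b + 8) + 2)) _.
  by apply: (emits_for (io := fun=> io)).
by rewrite /for_time leq_add2r leq_mul2r mM orbT.
Qed.

(* Counter 0 is the order [n], counters 1 and 2 are the numbers of grid rows
   before and after the current one, counters 3 and 4 those of grid columns, and
   counters 5 and 6 serve for loops that restore what they count down. *)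
Definition plain : prog := emit plain_letters.
Definition plain_row : prog := For 0 6 plain.
Definition block (i j k i' j' : nat) : prog := emit (block_letters [::] (symbols i j k i' j')).

(** Vertex 7 is the only one with a weight from the input. This weight comes first in its block, so
    a copied word followed by a constant text is all that is needed. *)
Definition same_block (k : nat) : prog :=
  if k == 7 then Seq copy_word (emit (block_letters [::] (behead (symbols 1 0 7 1 0))))
  else block 1 0 k 1 0.

(** Stack 6 is counter 4. It is lowered by one while the blocks beyond the right neighbour are
    written, and then restored. *)
Definition right_blocks (k : nat) : prog :=
  If 6 nonempty (Seq (Pop 6) (Seq (block 1 0 k 1 1) (Seq (For 4 5 plain) (Push 6 (Some true)))))
    Skip.

Definition grid_row (k : nat) : prog :=
  Seq (For 1 5 plain_row) (Seq (For 3 5 plain) (Seq (block 1 0 k 0 0) (Seq (For 4 5 plain)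
  (Seq (For 3 5 plain) (Seq (same_block k) (Seq (right_blocks k) (For 2 5 plain_row))))))).

Definition top_row (k : nat) : prog :=
  if k == 8 then
    Seq plain_row (Seq (For 3 5 plain_row) (Seq (block 0 0 8 1 0) (Seq (For 3 5 plain)
    (Seq (For 4 5 plain) (For 4 5 plain_row)))))
  else Seq (For 3 5 plain) (Seq (block 0 0 k 0 0) (Seq (For 4 5 plain) (For 2 5 plain_row))).

Section Rows.
Variables (n M : nat).
Hypothesis nM : n <= M.

Lemma emits_plain c io : emits plain c io plain_letters io block_time.
Proof. exact: emits_block. Qed.

Lemma emits_block_symbols c io i j k i' j' :
  emits (block i j k i' j') c io (block_letters [::] (symbols i j k i' j')) io block_time.
Proof. by apply: emits_block. Qed.

Definition row_time : nat := for_time M block_time.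

Lemma emits_plain_row i1 i2 j1 j2 t io :
  emits plain_row [:: n; i1; i2; j1; j2; t; 0] io (plain_row_letters n) io row_time.
Proof.
by apply: (@emits_for_const (fun a a' => [:: a; i1; i2; j1; j2; t; a'])) => // a a'; apply: emits_plain.
Qed.

Lemma emits_i1_rows i1 i2 j1 j2 io : i1 <= M ->
  emits (For 1 5 plain_row) [:: n; i1; i2; j1; j2; 0; 0] io
    (flatten (nseq i1 (plain_row_letters n))) io (for_time M row_time).
Proof.
by apply: (@emits_for_const (fun a a' => [:: n; a; i2; j1; j2; a'; 0])) => // a a'; apply: emits_plain_row.
Qed.

Lemma emits_i2_rows i1 i2 j1 j2 io : i2 <= M ->
  emits (For 2 5 plain_row) [:: n; i1; i2; j1; j2; 0; 0] io
    (flatten (nseq i2 (plain_row_letters n))) io (for_time M row_time).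
Proof.
by apply: (@emits_for_const (fun a a' => [:: n; i1; a; j1; j2; a'; 0])) => // a a'; apply: emits_plain_row.
Qed.

Lemma emits_j1_rows i1 i2 j1 j2 io : j1 <= M ->
  emits (For 3 5 plain_row) [:: n; i1; i2; j1; j2; 0; 0] io
    (flatten (nseq j1 (plain_row_letters n))) io (for_time M row_time).
Proof.
by apply: (@emits_for_const (fun a a' => [:: n; i1; i2; a; j2; a'; 0])) => // a a'; apply: emits_plain_row.
Qed.

Lemma emits_j2_rows i1 i2 j1 j2 io : j2 <= M ->
  emits (For 4 5 plain_row) [:: n; i1; i2; j1; j2; 0; 0] io
    (flatten (nseq j2 (plain_row_letters n))) io (for_time M row_time).
Proof.
by apply: (@emits_for_const (fun a a' => [:: n; i1; i2; j1; a; a'; 0])) => // a a'; apply: emits_plain_row.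
Qed.

Lemma emits_j1_plain i1 i2 j1 j2 io : j1 <= M ->
  emits (For 3 5 plain) [:: n; i1; i2; j1; j2; 0; 0] io
    (flatten (nseq j1 plain_letters)) io row_time.
Proof.
by apply: (@emits_for_const (fun a a' => [:: n; i1; i2; a; j2; a'; 0])) => // a a'; apply: emits_plain.
Qed.

Lemma emits_j2_plain i1 i2 j1 j2 io : j2 <= M ->
  emits (For 4 5 plain) [:: n; i1; i2; j1; j2; 0; 0] io
    (flatten (nseq j2 plain_letters)) io row_time.
Proof.
by apply: (@emits_for_const (fun a a' => [:: n; i1; i2; j1; a; a'; 0])) => // a a'; apply: emits_plain.
Qed.

(** The word of a cell stays in the input until the row of vertex 7 has been written. *)
Definition pending (k : nat) (g : seq bool) (io : seq letter) : seq letter :=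
  if k <= 7 then letters g ++ io else io.

Lemma emits_same_block c k g io : k < 9 -> size g <= M ->
  emits (same_block k) c (pending k g io) (block_letters g (symbols 1 0 k 1 0)) (pending k.+1 g io)
    (5 * M + 4 + block_time).
Proof.
move=> k9 gM; rewrite /same_block /pending.
have [->|k7] := eqVneq k 7.
  have -> : block_letters g (symbols 1 0 7 1 0) =
     letters g ++ block_letters [::] (behead (symbols 1 0 7 1 0)) by [].
  apply: emits_seq; last exact: emits_block.
  by apply: emits_leq (emits_copy_word _ _ _) _; lia.
have -> : (k < 7) = (k <= 7) by rewrite ltn_neqAle k7.
rewrite block_lettersW; last by case: k k9 k7 => [|[|[|[|[|[|[|[|[|]]]]]]]]].
by apply: emits_leq (emits_block_symbols _ _ _ _ _ _ _) _; rewrite leq_addl.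
Qed.

Lemma emits_right_blocks i1 i2 j1 j2 k io : j2 <= M ->
  emits (right_blocks k) [:: n; i1; i2; j1; j2; 0; 0] io
    (if j2 is j2'.+1 then block_letters [::] (symbols 1 0 k 1 1) ++ flatten (nseq j2' plain_letters)
     else [::]) io (block_time + row_time + 4).
Proof.
move=> j2M o; have -> : block_time + row_time + 4 = (1 + (block_time + (row_time + 2))).+1 by lia.
apply: runs_if; rewrite top_counter /=; case: j2 j2M => [|j2] j2M /=.
  by apply: runs_leq (emits_skip _ _ o) _.
apply: runs_seq; first exact: runs_pop_counter.
rewrite rev_cat -catA; apply: runs_seq; first exact: emits_block_symbols.
apply: runs_seq; first by apply: emits_j2_plain; apply: ltnW.
exact: (runs_push_counter [:: n; i1; i2; j1; j2; 0; 0]).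
Qed.

Definition grid_time : nat :=
  for_time M row_time + (row_time + (block_time + (row_time + (row_time +
    (5 * M + 4 + block_time + (block_time + row_time + 4 + for_time M row_time)))))).

Lemma emits_grid_row i j k g io : i < n -> j < n -> k < 9 -> size g <= M ->
  emits (grid_row k) [:: n; i; n - i.+1; j; n - j.+1; 0; 0] (pending k g io)
    (row_letters n g i.+1 j k) (pending k.+1 g io) grid_time.
Proof.
move=> lin ljn k9 gM; rewrite grid_row_letters //.
apply: emits_seq; first by apply: emits_i1_rows; lia.
apply: emits_seq; first by apply: emits_j1_plain; lia.
apply: emits_seq; first exact: emits_block_symbols.
apply: emits_seq; first by apply: emits_j2_plain; lia.
apply: emits_seq; first by apply: emits_j1_plain; lia.
apply: emits_seq; first exact: emits_same_block.
apply: emits_seq; first by apply: emits_right_blocks; lia.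
by apply: emits_i2_rows; lia.
Qed.

Definition top_time : nat :=
  row_time + (for_time M row_time + (block_time + (row_time + (row_time + for_time M row_time)))).

Lemma emits_top_row j k g io : j < n -> k < 9 ->
  emits (top_row k) [:: n; 0; n; j; n - j.+1; 0; 0] io (row_letters n g 0 j k) io top_time.
Proof.
move=> ljn k9; rewrite /top_row; have [->|k8] := eqVneq k 8.
  rewrite return_row_letters //.
  apply: emits_seq; first exact: emits_plain_row.
  apply: emits_seq; first by apply: emits_j1_rows; lia.
  apply: emits_seq; first exact: emits_block_symbols.
  apply: emits_seq; first by apply: emits_j1_plain; lia.
  apply: emits_seq; first by apply: emits_j2_plain; lia.
  by apply: emits_j2_rows; lia.
rewrite top_row_letters //; last by rewrite ltn_neqAle k8 -ltnS.
apply: (@emits_leq _ _ _ _ _ (row_time + (block_time + (row_time + for_time M row_time)))).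
  apply: emits_seq; first by apply: emits_j1_plain; lia.
  apply: emits_seq; first exact: emits_block_symbols.
  apply: emits_seq; first by apply: emits_j2_plain; lia.
  exact: emits_i2_rows.
by rewrite /top_time; lia.
Qed.

End Rows.

(** An equality instead of an upper bound, so that closure under sums and products needs no
    monotonicity. *)
Definition poly_bound (f : nat -> nat) : Prop := exists p : {poly nat}, forall m, p.[m]%R = f m.

Lemma poly_bound_const a : poly_bound (fun=> a).
Proof. by exists a%:P%R => m; rewrite hornerC. Qed.

Lemma poly_bound_id : poly_bound id.
Proof. by exists 'X%R => m; rewrite hornerX. Qed.

Lemma poly_boundD f g : poly_bound f -> poly_bound g -> poly_bound (fun m => f m + g m).
Proof. by move=> [p Hp] [q Hq]; exists (p + q)%R => m; rewrite hornerD Hp Hq. Qed.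

Lemma poly_boundM f g : poly_bound f -> poly_bound g -> poly_bound (fun m => f m * g m).
Proof. by move=> [p Hp] [q Hq]; exists (p * q)%R => m; rewrite hornerM Hp Hq. Qed.

Lemma flatten_allpairs (S T U : Type) (F : S -> T -> seq U) s t :
  flatten [seq F x y | x <- s, y <- t] = flatten [seq flatten [seq F x y | y <- t] | x <- s].
Proof. by elim: s => //= x s <-; rewrite flatten_cat. Qed.

Lemma flatten_nseq (T : Type) (a : T) m p : flatten (nseq m (nseq p a)) = nseq (m * p) a.
Proof. by elim: m => //= m ->; rewrite mulSn nseqD. Qed.

Definition words (G : coded_digraph) : seq (seq bool) :=
  [seq dg_weight G i j | i <- enum 'I_(dg_order G), j <- enum 'I_(dg_order G)].

Lemma size_words G : size (words G) = dg_order G * dg_order G.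
Proof. by rewrite size_allpairs size_enum_ord. Qed.

Lemma encodeE G : encode G = ones (dg_order G) ++ None :: flatten [seq letters w | w <- words G].
Proof. by rewrite /encode /words map_allpairs. Qed.

Lemma nth_words G (i j : 'I_(dg_order G)) : nth [::] (words G) (i * dg_order G + j) = dg_weight G i j.
Proof.
case: G i j => n A i j; rewrite /words /=.
have gen (s : seq 'I_n) (m : nat) : m < size s ->
    nth [::] [seq A x y | x <- s, y <- enum 'I_n] (m * n + j) = A (nth i s m) j.
  elim: s m => //= x s IH [|m] lt; rewrite nth_cat size_map size_enum_ord.
    by rewrite mul0n add0n ltn_ord (nth_map i) ?size_enum_ord // nth_ord_enum.
  by rewrite ifN -?leqNgt mulSn -addnA ?leq_addr // addKn IH.
by rewrite gen ?size_enum_ord // nth_ord_enum.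
Qed.

Definition vertex_word (G : coded_digraph) (u : nat) : seq bool :=
  nth [::] (words G) ((u %/ 9 %/ dg_order G).-1 * dg_order G + u %/ 9 %% dg_order G).

Definition planarize (G : coded_digraph) : coded_digraph :=
  CodedDigraph (\matrix_(u < planar_order (dg_order G), v < planar_order (dg_order G))
    weight_code (vertex_word G u) (index_symbol (dg_order G) u v)).

Definition cell_letters (n : nat) (ws : seq (seq bool)) (i j : nat) : seq letter :=
  cats (fun k => row_letters n (nth [::] ws (i.-1 * n + j)) i j k) 0 9.

(** Dividing a vertex number by 9 and by [n] yields kind, grid column and grid row, so by [cats_mul]
    a loop over vertex numbers is a nested loop over triples, which is how the program runs. *)
Lemma encode_planarize G : encode (planarize G) =
  ones (planar_order (dg_order G)) ++ None ::
  cats (fun i => cats (cell_letters (dg_order G) (words G) i) 0 (dg_order G)) 0 (dg_order G).+1.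
Proof.
rewrite /encode flatten_allpairs; congr (_ ++ _ :: _) => /=.
set n := dg_order G; set N := planar_order n.
pose F u v := letters (weight_code (vertex_word G u) (index_symbol n u v)).
transitivity (cats (fun u => cats (F u) 0 N) 0 N).
  rewrite /cats -val_enum_ord -map_comp; congr flatten; apply: eq_map => u /=.
  by rewrite -map_comp; congr flatten; apply: eq_map => v /=; rewrite mxE.
rewrite {2}/N /planar_order cats_mul cats_mul; apply: eq_cats => i /= iln.
apply: eq_cats => j /= jln; apply: eq_cats => k /= k9.
have n0 : 0 < n := leq_ltn_trans (leq0n j) jln.
have divE x y : y < 9 -> (x * 9 + y) %/ 9 = x by move=> y9; rewrite divnMDl // divn_small ?addn0.
have modE x y : y < 9 -> (x * 9 + y) %% 9 = y by move=> y9; rewrite modnMDl modn_small.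
have divE' x y : y < n -> (x * n + y) %/ n = x by move=> yn; rewrite divnMDl // divn_small ?addn0.
have modE' x y : y < n -> (x * n + y) %% n = y by move=> yn; rewrite modnMDl modn_small.
rewrite /N /planar_order cats_mul cats_mul /row_letters; apply: eq_cats => i' /= iln'.
apply: eq_cats => j' /= jln'; rewrite /block_letters /symbols -map_comp.
apply: eq_cats => k' /= k9'.
by rewrite /F /vertex_word /index_symbol -/n !divE ?modE ?divE' ?modE'.
Qed.

Definition header : prog :=
  Seq (For 2 5 (For 0 6 (emit (ones 9)))) (Seq (For 0 6 (emit (ones 9))) (emit [:: None])).

Definition body : prog :=
  Seq header (Seq (For 4 3 (seqs (map top_row (iota 0 9))))
                  (For 2 1 (For 4 3 (seqs (map grid_row (iota 0 9)))))).

Definition setup : prog :=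
  Seq (While 0 is_one (Seq (Pop 0)
        (Seq (Push 2 (Some true)) (Seq (Push 4 (Some true)) (Push 6 (Some true))))))
      (Pop 0).

Definition finish : prog :=
  While 1 nonempty (If 1 is_separator (Seq (Pop 1) (Push 0 None))
    (If 1 is_one (Seq (Pop 1) (Push 0 (Some true))) (Seq (Pop 1) (Push 0 (Some false))))).

Section Body.
Variables (n M : nat) (ws : seq (seq bool)).
Hypotheses (nM : n <= M) (size_ws : size ws = n * n) (wsM : forall w, w \in ws -> size w <= M).

Definition from_word (t : nat) : seq letter := flatten [seq letters w | w <- drop t ws].

Definition header_time : nat :=
  for_time M (for_time M (2 * 9).+1) + (for_time M (2 * 9).+1 + 3).

Lemma emits_header io : emits header [:: n; 0; n; 0; n; 0; 0] io
  (ones (planar_order n) ++ [:: None]) io header_time.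
Proof.
(* The factor [n + 1] is split off because the counters hold [n] but not [n + 1]. *)
have -> : ones (planar_order n) =
    flatten (nseq n (flatten (nseq n (ones 9)))) ++ flatten (nseq n (ones 9)).
  by rewrite !flatten_nseq -nseqD /ones; congr nseq; rewrite /planar_order; lia.
have inner t io' i2 : emits (For 0 6 (emit (ones 9))) [:: n; 0; i2; 0; n; t; 0] io'
    (flatten (nseq n (ones 9))) io' (for_time M (2 * 9).+1).
  by apply: (@emits_for_const (fun a a' => [:: a; 0; i2; 0; n; t; a'])) => // a a'; apply: (emits_emit _ _ (ones 9)).
rewrite -catA; apply: emits_seq.
  by apply: (@emits_for_const (fun a a' => [:: n; 0; a; 0; n; a'; 0])) => // a a'; apply: inner.
by apply: emits_seq; [exact: inner | exact: (emits_emit _ _ [:: None])].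
Qed.

Lemma for_time_leq m b : m <= M -> m * (b + 8) + 2 <= for_time M b.
Proof. by move=> mM; rewrite /for_time leq_add2r leq_mul2r mM orbT. Qed.

Lemma emits_top io : emits (For 4 3 (seqs (map top_row (iota 0 9)))) [:: n; 0; n; 0; n; 0; 0] io
  (cats (cell_letters n ws 0) 0 n) io (for_time M (9 * top_time M).+1).
Proof.
apply: emits_leq (for_time_leq _ nM).
apply: (emits_for (c := fun a a' => [:: n; 0; n; a'; a; 0; 0]) (io := fun=> io)) => // j ljn.
apply: (emits_seqs (a := 0) (io := fun=> io)) => k /= k9.
exact: emits_top_row.
Qed.

(** Cells are written in row-major order, as the input words are, so the cell finds exactly its own
    word at the front of the input and consumes it. *)
Lemma emits_cell i j : i < n -> j < n ->
  emits (seqs (map grid_row (iota 0 9))) [:: n; i; n - i.+1; j; n - j.+1; 0; 0]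
    (from_word (i * n + j)) (cell_letters n ws i.+1 j) (from_word (i * n + j).+1)
    (9 * grid_time M).+1.
Proof.
move=> lin ljn; set t := i * n + j; pose g := nth [::] ws t.
have tws : t < size ws.
  rewrite size_ws; apply: (@leq_trans (i.+1 * n)); first by rewrite /t mulSn [n + _]addnC ltn_add2l.
  by rewrite leq_mul2r lin orbT.
have -> : from_word t = pending 0 g (from_word t.+1) by rewrite /from_word (drop_nth [::]).
apply: (emits_seqs (a := 0) (io := fun k => pending k g (from_word t.+1))) => k /= k9.
by apply: emits_grid_row => //; apply: wsM; rewrite mem_nth.
Qed.

Lemma emits_grid : emits (For 2 1 (For 4 3 (seqs (map grid_row (iota 0 9)))))
  [:: n; 0; n; 0; n; 0; 0] (from_word 0) (cats (fun i => cats (cell_letters n ws i.+1) 0 n) 0 n)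
  (from_word (n * n)) (for_time M (for_time M (9 * grid_time M).+1)).
Proof.
apply: emits_leq (for_time_leq _ nM).
apply: (emits_for (c := fun a a' => [:: n; a'; a; 0; n; 0; 0]) (io := fun i => from_word (i * n))) => // i lin.
apply: emits_leq (for_time_leq _ nM).
rewrite mulSn [n + _]addnC -{1}[i * n]addn0.
apply: (emits_for (c := fun a a' => [:: n; i; n - i.+1; a'; a; 0; 0])
  (io := fun j => from_word (i * n + j))) => // j ljn.
by rewrite addnS; apply: emits_cell.
Qed.

Definition body_time : nat :=
  header_time + (for_time M (9 * top_time M).+1 + for_time M (for_time M (9 * grid_time M).+1)).

Lemma emits_body : emits body [:: n; 0; n; 0; n; 0; 0] (from_word 0)
  (ones (planar_order n) ++ None :: cats (fun i => cats (cell_letters n ws i) 0 n) 0 n.+1)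
  [::] body_time.
Proof.
rewrite -cat_rcons -cats1 catsS [cats _ 1 n]cats_add.
have E : [::] = from_word (n * n) by rewrite /from_word drop_oversize ?size_ws.
rewrite [X in emits _ _ _ _ X _]E.
apply: emits_seq; first exact: emits_header.
by apply: emits_seq; [exact: emits_top | exact: emits_grid].
Qed.

End Body.

Definition reduction : prog := Seq setup (Seq body finish).

Lemma runs_setup n (io : seq letter) : runs setup (cstore [:: 0; 0; 0; 0; 0; 0; 0] (ones n ++ None :: io) [::])
  (8 * n + 2) (cstore [:: n; 0; n; 0; n; 0; 0] io [::]).
Proof.
have -> : 8 * n + 2 = (8 * n).+1 + 1 by lia.
apply: runs_seq (_ : runs _ _ _ (cstore [:: n; 0; n; 0; n; 0; 0] (None :: io) [::])) _; last first.
  exact: (emits_pop_io _ None io [::]).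
suff H m a : runs (While 0 is_one (Seq (Pop 0)
        (Seq (Push 2 (Some true)) (Seq (Push 4 (Some true)) (Push 6 (Some true))))))
    (cstore [:: a; 0; a; 0; a; 0; 0] (ones m ++ None :: io) [::]) (8 * m).+1
    (cstore [:: m + a; 0; m + a; 0; m + a; 0; 0] (None :: io) [::]).
  by have := H n 0; rewrite addn0.
elim: m a => [|m IH] a; first by apply: runs_while0.
have -> : (8 * m.+1).+1 = ((1 + (2 + (2 + 2))) + (8 * m).+1).+1 by lia.
apply: (runs_while (st1 := cstore [:: a.+1; 0; a.+1; 0; a.+1; 0; 0] (ones m ++ None :: io) [::])) => //.
  apply: runs_seq; first exact: (emits_pop_io _ (Some true) _ [::]).
  apply: runs_seq; first exact: (runs_push_counter _ _ _ 0).
  apply: runs_seq; first exact: (runs_push_counter _ _ _ 2).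
  exact: (runs_push_counter _ _ _ 4).
by rewrite addSnnS; apply: IH.
Qed.

Lemma runs_finish c io o : runs finish (cstore c io o) (6 * size o).+1 (cstore c (rev o ++ io) [::]).
Proof.
have push l a x : runs (Push 0 x) (cstore c l a) 2 (cstore c (x :: l) a).
  by exists 2 => //; apply: (exec_push 0 x (cstore c l a)).
have pop l x a : runs (Pop 1) (cstore c l (x :: a)) 1 (cstore c l a).
  by exists 1 => //; apply: (exec_pop 1 (cstore c l (x :: a))).
elim: o io => [|x o IH] io; first exact: runs_while0.
have -> : (6 * size (x :: o)).+1 = (5 + (6 * size o).+1).+1 by rewrite /=; lia.
rewrite rev_cons cat_rcons; apply: runs_while (IH _) => //.
case: x => [[]|].
- by do 2!apply: runs_if; exact: runs_seq (pop _ _ _) (push _ _ _).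
- by do 2!apply: runs_if; exact: runs_seq (pop _ _ _) (push _ _ _).
by apply: runs_if; apply: (@runs_leq _ _ (1 + 2)) => //; exact: runs_seq (pop _ _ _) (push _ _ _).
Qed.

Definition reduction_time (m : nat) : nat := (8 * m + 2) + (body_time m + (6 * body_time m).+1).

Lemma runs_reduction G :
  runs reduction (encode G :: nseq 8 [::]) (reduction_time (size (encode G)))
    (cstore [:: dg_order G; 0; dg_order G; 0; dg_order G; 0; 0] (encode (planarize G)) [::]).
Proof.
set n := dg_order G; set M := size (encode G).
have nM : n <= M by rewrite /M encodeE size_cat size_nseq leq_addr.
have wM w : w \in words G -> size w <= M.
  move=> wG; rewrite /M encodeE size_cat /=; apply: leq_trans (leq_addl _ _); apply: leqW.
  rewrite (size_flatten) /shape -map_comp.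
  elim: (words G) wG => //= v ws IH; rewrite inE => /orP[/eqP ->|/IH].
    by rewrite /letters size_rcons size_map (leq_trans (leqnSn _)) ?leq_addr.
  by move=> le; apply: leq_trans le (leq_addl _ _).
have [m mt ex] := emits_body nM (size_words G) wM [::].
move: ex; rewrite cats0 -encode_planarize => ex.
have le : size (rev (encode (planarize G))) <= body_time M.
  by have := exec_size 1 ex; rewrite /= add0n => /leq_trans; apply.
have H1 : runs setup (encode G :: nseq 8 [::]) (8 * M + 2)
    (cstore [:: n; 0; n; 0; n; 0; 0] (from_word (words G) 0) [::]).
  rewrite encodeE /from_word drop0; apply: (runs_leq (runs_setup n _)).
  by rewrite leq_add2r leq_mul2l nM.
have H2 := runs_finish [:: n; 0; n; 0; n; 0; 0] [::] (rev (encode (planarize G))).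
rewrite revK cats0 in H2.
apply: runs_seq H1 (runs_seq _ (runs_leq H2 _)); first by exists m.
by rewrite ltnS leq_mul2l le orbT.
Qed.

Lemma poly_bound_for_time f g : poly_bound f -> poly_bound g -> poly_bound (fun m => for_time (f m) (g m)).
Proof.
move=> Hf Hg; do 2?[apply: poly_boundD; last exact: poly_bound_const]; apply: poly_boundM => //.
by apply: poly_boundD => //; apply: poly_bound_const.
Qed.

Lemma poly_boundS f : poly_bound f -> poly_bound (fun m => (f m).+1).
Proof.
by move=> H; have [p Hp] := poly_boundD H (poly_bound_const 1); exists p => m; rewrite Hp addn1.
Qed.

Lemma poly_bound_reduction : poly_bound reduction_time.
Proof.
have row : poly_bound (fun m => row_time m).
  by apply: poly_bound_for_time; [exact: poly_bound_id | exact: poly_bound_const].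
have B : poly_bound body_time.
  rewrite /body_time /header_time /top_time /grid_time.
  by do ?[exact: row | exact: poly_bound_id | exact: poly_bound_const | apply: poly_bound_for_time
     | apply: poly_boundS | apply: poly_boundD | apply: poly_boundM].
rewrite /reduction_time.
by do ?[exact: B | exact: poly_bound_id | exact: poly_bound_const
     | apply: poly_boundS | apply: poly_boundD | apply: poly_boundM].
Qed.

Lemma stacks_below_emit k s : 1 < k -> stacks_below k (emit s).
Proof. by move=> k1; rewrite /emit; elim: s => //= a s IH; rewrite k1. Qed.

Lemma stacks_below_block k i j k' i' j' : 1 < k -> stacks_below k (block i j k' i' j').
Proof. exact: stacks_below_emit. Qed.

Lemma stacks_below_plain k : 1 < k -> stacks_below k (plain).
Proof. exact: stacks_below_emit. Qed.

Lemma stacks_below_seqs k (P : nat -> prog) m : (forall i, stacks_below k (P i)) ->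
  stacks_below k (seqs (map P (iota 0 m))).
Proof. by move=> H; elim: (iota 0 m) => //= i s ->; rewrite H. Qed.

Local Arguments emit : simpl never.
Local Arguments block : simpl never.
Local Arguments plain : simpl never.
Local Arguments same_block : simpl never.
Local Arguments seqs : simpl never.

Lemma stacks_below_reduction : stacks_below 9 reduction.
Proof.
have top i : stacks_below 9 (top_row i).
  by rewrite /top_row; case: ifP => _; rewrite /= !stacks_below_plain // !stacks_below_block.
have grid i : stacks_below 9 (grid_row i).
  have same : stacks_below 9 (same_block i).
    rewrite /same_block; case: ifP => _; last exact: stacks_below_block.
    by rewrite /= stacks_below_emit.
  by rewrite /= !stacks_below_plain // !stacks_below_block // same.
by rewrite /= !stacks_below_emit // !stacks_below_seqs.
Qed.

Theorem polytime_planarize : polytime encode encode planarize.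
Proof.
have [b Hb] := poly_bound_reduction.
(* The eight extra tapes are the output and the seven counters. *)
apply: (@polytime_prog _ _ _ _ _ 8 reduction b) => [|G]; first exact: stacks_below_reduction.
have [m mt ex] := runs_reduction G.
by exists m, (cstore [:: dg_order G; 0; dg_order G; 0; dg_order G; 0; 0] (encode (planarize G)) [::]); rewrite Hb.
Qed.

End Reduction.

Local Open Scope ring_scope.

(** * Signed permanents over the integers *)

Definition weight_val (R : pzRingType) (e a : R) (w : weight) : R :=
  match w with W0 => 0 | W1 => 1 | WN => -1 | WE => e | WG => a end.

(* The weights inside a cell.  The row wire enters at vertex 7, which chooses
   between 0, the turn, and 1, the crossing; the column wire enters at 8.  Vertex
   5 is the correction, 3 and 4 lie between it and the crossing, and the column
   and the row wire leave at 2 and 6. *)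

Definition upd_row (V : eqType) (B : V -> V -> int) (p : V) (r : V -> int) : V -> V -> int :=
  fun i => if i == p then r else B i.

Definition unit_row (V : eqType) (v : V) : V -> int := fun x => (x == v)%:R.

(** Permanent for [e = 1] and determinant for [e = -1]. Functions on a finite type take the place of
    matrices, so that vertices can be triples. *)
Definition signed_perm (e : int) (V : finType) (B : V -> V -> int) : int :=
  \sum_(s : {perm V}) e ^+ s * \prod_i B i (s i).

Section SignedPerm.
Variables (e : int) (V : finType).
Hypothesis e2 : e * e = 1.
Implicit Types (B C : V -> V -> int) (r : V -> int) (p q x : V).
Local Notation sp := (signed_perm e (V:=V)).

Lemma eq_signed_perm B C : B =2 C -> sp B = sp C.
Proof. by move=> E; apply: eq_bigr => s _; congr (_ * _); apply: eq_bigr => i _. Qed.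

Lemma signed_perm_row_lin B p (a b : int) r1 r2 :
  sp (upd_row B p (fun x => a * r1 x + b * r2 x)) =
  a * sp (upd_row B p r1) + b * sp (upd_row B p r2).
Proof.
rewrite /signed_perm !big_distrr -big_split; apply: eq_bigr => s _ /=.
have E r : \prod_i upd_row B p r i (s i) = r (s p) * \prod_(i | i != p) B i (s i).
  rewrite (bigD1 p) //= /upd_row eqxx; congr (_ * _).
  by apply: eq_bigr => i /negbTE ->.
rewrite !E; move: (e ^+ s) (r1 _) (r2 _) (\prod_(i | _) _) => c u v w; ring.
Qed.

Lemma signed_perm_dep B p q k : p != q ->
  (forall y, y != k -> B p y = 0) -> (forall y, y != k -> B q y = 0) -> sp B = 0.
Proof.
move=> pq Bp Bq; apply: big1 => s _.
rewrite (bigD1 p) //= (bigD1 q) 1?eq_sym //=.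
have [spk|/Bp ->] := eqVneq (s p) k; last by rewrite mul0r mulr0.
rewrite Bq ?mul0r ?mulr0 //; apply: contraNneq pq => sqk.
by apply/eqP/(@perm_inj _ s); rewrite spk sqk.
Qed.

(** The unit row forces every contributing permutation to fix [x], so no other row ever uses column
    [x]. *)
Lemma signed_perm_isolated B C x : B x =1 unit_row x -> C x =1 unit_row x ->
  (forall i y, i != x -> y != x -> B i y = C i y) -> sp B = sp C.
Proof.
move=> Bx Cx E; apply: eq_bigr => s _; congr (_ * _).
rewrite !(bigD1 x (P := predT)) //= Bx Cx /unit_row.
have [sx|] := eqVneq (s x) x; last by rewrite !mul0r.
congr (_ * _); apply: eq_bigr => i ix; apply: E => //.
by apply: contraNneq ix => si; apply/eqP/(@perm_inj _ s); rewrite si sx.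
Qed.

Lemma sign_tperm_mul p x (s : {perm V}) : p != x -> e ^+ (tperm x p * s)%g = e * e ^+ s.
Proof.
move=> px; rewrite odd_permM odd_tperm eq_sym px /=.
by case: (s : bool) => /=; rewrite ?expr0 ?expr1 ?mulr1 ?e2.
Qed.

(** Laplace expansion along column [x] without changing the index type: when row [p] takes column
    [x], row [x] moves to the place of [p] at the price of [e], and [x] becomes isolated. *)
Lemma signed_perm_expand B x :
  sp B = B x x * sp (upd_row B x (unit_row x)) +
    e * \sum_(p | p != x) B p x * sp (upd_row (upd_row B p (B x)) x (unit_row x)).
Proof.
have dlt C : sp (upd_row C x (unit_row x)) =
    \sum_(s : {perm V} | s x == x) e ^+ s * \prod_(i | i != x) C i (s i).
  rewrite /signed_perm [RHS]big_mkcond; apply: eq_bigr => s _.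
  rewrite (bigD1 x) //= /upd_row eqxx /unit_row.
  case: (s x == x); last by rewrite mul0r mulr0.
  by rewrite mul1r; congr (_ * _); apply: eq_bigr => i /negbTE ->.
rewrite {1}/signed_perm (partition_big (fun s : {perm V} => (s^-1)%g x) predT) //=.
rewrite (bigD1 x) //= dlt; congr (_ + _).
  rewrite big_distrr /=; apply: eq_big => [s|s /eqP sx].
    by rewrite -{1}(inj_eq (@perm_inj _ s)) permKV eq_sym.
  rewrite (bigD1 x) //=; have -> : s x = x by rewrite -{1}sx permKV.
  by rewrite mulrCA.
rewrite big_distrr /=; apply: eq_bigr => p px; rewrite dlt !big_distrr /=.
(* Multiplication by the transposition turns the permutations that send [p] to [x] into those that
   fix [x]. *)
rewrite (reindex_inj (mulgI (tperm x p))) /=.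
apply: eq_big => [s|s /eqP sx].
  rewrite invMg permM tpermV; rewrite -(inj_eq (@perm_inj _ (tperm x p))) tpermK tpermR.
  by rewrite -(inj_eq (@perm_inj _ s)) permKV eq_sym.
have sx' : s x = x.
  move: sx; rewrite invMg permM tpermV => /(congr1 (tperm x p)); rewrite tpermK tpermR.
  by move=> /(congr1 s); rewrite permKV.
rewrite sign_tperm_mul // (bigD1 p) //= (bigD1 x) 1?eq_sym //= !permM tpermL tpermR sx'.
rewrite [X in _ = _ * (_ * (_ * X))](bigD1 p) //= /upd_row eqxx.
rewrite [X in _ * (_ * (_ * X)) = _](eq_bigl (fun i => (i != x) && (i != p))); last by move=> i; rewrite andbC.
rewrite [X in _ * (_ * (_ * X)) = _](eq_bigr (fun i => (if i == p then B x else B i) (s i))); last first.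
  by move=> i /andP[ix ip]; rewrite permM tpermD ?(negbTE ip) // eq_sym.
move: (e ^+ s) (B p x) (B x _) (\prod_(i | _) _) => c u v w.
ring.
Qed.

End SignedPerm.

(** * Laplace expansion with undetermined rows *)

Section Laplace.
Variables (e : int) (V : finType).
Hypothesis e2 : e * e = 1.
Implicit Types (B C R : V -> V -> int) (r f g : V -> int) (p q x : V).
Local Notation sp := (signed_perm e (V:=V)).

Lemma signed_perm_swap B p q r f : p != q ->
  sp (upd_row (upd_row B p r) q f) = e * sp (upd_row (upd_row B p f) q r).
Proof.
move=> pq; rewrite /signed_perm big_distrr /= (reindex_inj (mulgI (tperm q p))) /=.
apply: eq_bigr => s _; rewrite sign_tperm_mul // -mulrA; congr (_ * (_ * _)).
have qp : q != p by rewrite eq_sym.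
rewrite !(bigD1 q (P := predT)) //= !(bigD1 p (P := fun i => i != q)) //= !permM tpermL tpermR.
rewrite /upd_row !eqxx !(negbTE pq) mulrCA; congr (_ * (_ * _)).
apply: eq_bigr => i /andP[iq ip].
by rewrite (negbTE iq) (negbTE ip) permM tpermD // eq_sym.
Qed.

Fixpoint lin_comb (a : seq int) (fs : seq (V -> int)) : V -> int :=
  match a, fs with
  | c :: a', f :: fs' => fun x => c * f x + lin_comb a' fs' x
  | _, _ => fun=> 0
  end.

(** Rows are coefficient lists over [fs], which will consist of the unit rows of the columns to be
    eliminated and of rows left arbitrary; thus one numerical table describes a cell wherever it
    lies in the grid. *)
Fixpoint put_rows (vs : seq V) (rows : seq (seq int)) (fs : seq (V -> int)) R :=
  match vs, rows with
  | v :: vs', r :: rows' => upd_row (put_rows vs' rows' fs R) v (lin_comb r fs)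
  | _, _ => R
  end.

Lemma lin_comb0 a fs x : (forall f, List.In f fs -> f x = 0) -> lin_comb a fs x = 0.
Proof.
elim: fs a => [|f fs IH] [|c a] //= H.
by rewrite H ?mulr0 ?add0r; [apply: IH => g Hg; apply: H; right | left].
Qed.

Lemma put_rowsN vs rows fs R v : v \notin vs -> put_rows vs rows fs R v = R v.
Proof.
elim: vs rows => [|w vs IH] [|r rows] //=.
by rewrite inE negb_or /upd_row => /andP[/negbTE -> /IH ->].
Qed.

Lemma put_rows_nth vs rows fs R k v0 : uniq vs -> size rows = size vs ->
  (k < size vs)%N -> put_rows vs rows fs R (nth v0 vs k) = lin_comb (nth [::] rows k) fs.
Proof.
elim: vs rows k => [|w vs IH] [|r rows] //= k /andP[wvs uvs] [Hs].
case: k => [|k] Hk /=; first by rewrite /upd_row eqxx.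
rewrite /upd_row; case: eqP => [E|_]; last exact: IH.
by move: wvs; rewrite -E mem_nth.
Qed.

(** The other elements of [fs] and the rows outside the list vanish at [x], so column [x] consists
    of the heads of the coefficient lists. *)
Lemma signed_perm_put_cons x vs h rx rest fs R :
  x \notin vs -> uniq vs -> size rest = size vs ->
  (forall f, List.In f fs -> f x = 0) ->
  (forall v, v \notin x :: vs -> R v x = 0) ->
  all (fun a : seq int => a != [::]) rest ->
  sp (put_rows (x :: vs) ((h :: rx) :: rest) (unit_row x :: fs) R) =
  h * sp (put_rows vs (map behead rest) fs (upd_row R x (unit_row x))) +
  e * \sum_(k < size rest) head 0 (nth [::] rest k) *
     sp (put_rows vs (set_nth [::] (map behead rest) k rx) fs (upd_row R x (unit_row x))).
Proof.
move=> xvs uvs szr fs0 R0 ne.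
set B := put_rows _ _ _ R; set R' := upd_row R x _.
have Bx : B x =1 lin_comb (h :: rx) (unit_row x :: fs) by rewrite /B /= /upd_row eqxx.
have Bxx : B x x = h by rewrite Bx /= /unit_row eqxx mulr1 lin_comb0 ?addr0.
have lc a y : a != [::] -> y != x ->
    lin_comb a (unit_row x :: fs) y = lin_comb (behead a) fs y.
  by case: a => //= c a _ /negbTE yx; rewrite /unit_row yx mulr0 add0r.
have R'x rows : put_rows vs rows fs R' x = unit_row x.
  by rewrite put_rowsN // /R' /upd_row eqxx.
have neK k : (k < size vs)%N -> nth [::] rest k != [::].
  by move=> kv; apply: (allP ne); rewrite mem_nth ?szr.
have Bk k : (k < size vs)%N ->
    B (nth x vs k) = lin_comb (nth [::] rest k) (unit_row x :: fs).
  move=> kv; rewrite /B /= /upd_row; case: eqP => [E|_].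
    by move: xvs; rewrite -E mem_nth.
  by rewrite put_rows_nth.
have notin v : v != x -> v \notin vs -> B v = R v.
  by move=> vx vvs; rewrite /B /= /upd_row (negbTE vx) put_rowsN.
rewrite (signed_perm_expand e2 _ x) Bxx; congr (_ * _ + e * _).
  apply: (@signed_perm_isolated _ _ _ _ x); rewrite ?R'x ?/upd_row ?eqxx //.
  move=> v y vx yx; rewrite (negbTE vx).
  have [vvs|vvs] := boolP (v \in vs); last first.
    by rewrite notin // put_rowsN // /R' /upd_row (negbTE vx).
  have kv : (index v vs < size vs)%N by rewrite index_mem.
  rewrite -(nth_index x vvs) Bk // put_rows_nth ?size_map //.
  by rewrite lc // ?neK // (nth_map [::]) ?szr.
transitivity (\sum_(p <- vs) B p x * sp (upd_row (upd_row B p (B x)) x (unit_row x))).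
  rewrite big_uniq //= (bigID (mem vs)) /= [X in _ + X]big1 ?addr0 => [|p /andP[px pvs]].
    by apply: eq_bigl => p; rewrite andb_idl // => pvs; apply: contraNneq xvs => <-.
  by rewrite notin // R0 ?mul0r // inE negb_or px.
rewrite (big_nth x) big_mkord -szr; apply: eq_bigr => -[k /= kr] _.
have kv : (k < size vs)%N by rewrite -szr.
rewrite Bk //; congr (_ * _).
  have := neK _ kv; case: (nth [::] rest k) => //= c r _.
  by rewrite /unit_row eqxx mulr1 lin_comb0 ?addr0.
set p := nth x vs k.
have px : p != x by apply: contraNneq xvs => <-; rewrite mem_nth.
have szn : size (set_nth [::] (map behead rest) k rx) = size vs.
  by rewrite size_set_nth size_map szr; apply/maxn_idPr.
apply: (@signed_perm_isolated _ _ _ _ x); rewrite ?R'x ?/upd_row ?eqxx //.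
move=> v y vx yx; rewrite (negbTE vx).
have [vvs|vvs] := boolP (v \in vs); last first.
  rewrite ifN; last by apply: contraNneq vvs => ->; rewrite mem_nth.
  by rewrite notin // put_rowsN // /R' /upd_row (negbTE vx).
have kv' : (index v vs < size vs)%N by rewrite index_mem.
rewrite -(nth_index x vvs) put_rows_nth // nth_set_nth /= /p nth_uniq //.
have [_|_] := eqVneq (index v vs) k; first by rewrite Bx lc.
by rewrite Bk // lc // ?neK // (nth_map [::]) ?szr.
Qed.

(* The terms of the Laplace expansion along the first [n] columns in which the
   last two rows are left with the columns [s] and [t]. *)
Fixpoint laplace (n : nat) (rows : seq (seq int)) (s t : nat) : int :=
  match n, rows with
  | 0, [:: a; b] => nth 0 a s * nth 0 b t
  | n'.+1, (h :: rx) :: rest =>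
      (if h == 0 then 0 else h * laplace n' (map behead rest) s t) +
      e * foldr (fun k acc => (if head 0 (nth [::] rest k) == 0 then 0 else
           head 0 (nth [::] rest k) *
             laplace n' (set_nth [::] (map behead rest) k rx) s t) + acc)
         0 (iota 0 (size rest))
  | _, _ => 0
  end.

Lemma lin_combE a fs x : size a = size fs ->
  lin_comb a fs x = \sum_(s < size fs) nth 0 a s * nth (fun=> 0) fs s x.
Proof.
elim: fs a => [|f fs IH] [|c a] //=; first by rewrite big_ord0.
by move=> [/IH ->]; rewrite big_ord_recl.
Qed.

Lemma signed_perm_row_sum B p (m : nat) (a : 'I_m -> int) (f : 'I_m -> V -> int) r :
  (forall x, r x = \sum_i a i * f i x) ->
  sp (upd_row B p r) = \sum_i a i * sp (upd_row B p (f i)).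
Proof.
elim: m a f r => [|m IH] a f r E.
  rewrite big_ord0; transitivity (sp (upd_row B p (fun x => 0 * r x + 0 * r x))).
    by apply: eq_signed_perm => i x; rewrite /upd_row; case: eqP => // _; rewrite E big_ord0 !mul0r addr0.
  by rewrite signed_perm_row_lin !mul0r addr0.
pose r' x := \sum_(i < m) a (lift ord0 i) * f (lift ord0 i) x.
transitivity (sp (upd_row B p (fun x => a ord0 * f ord0 x + 1 * r' x))).
  apply: eq_signed_perm => i x; rewrite /upd_row; case: ifP => // _.
  by rewrite E big_ord_recl mul1r.
rewrite signed_perm_row_lin big_ord_recl mul1r; congr (_ + _).
exact: (IH (fun i => a (lift ord0 i)) (fun i => f (lift ord0 i))).
Qed.

Lemma upd_rowC B p q r1 r2 : p != q ->
  upd_row (upd_row B p r1) q r2 =2 upd_row (upd_row B q r2) p r1.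
Proof.
move=> pq i x; rewrite /upd_row; case: eqP => // ->.
by rewrite eq_sym (negbTE pq).
Qed.

(** Each elimination removes one head from all coefficient lists. When [xs] is exhausted, the rows
    left at [s] and [t] are combinations of [fs] alone and are expanded bilinearly. *)
Lemma laplaceP xs s t fs R rows : uniq (xs ++ [:: s; t]) ->
  size rows = (size xs).+2 ->
  all (fun a : seq int => size a == size xs + size fs)%N rows ->
  (forall f x, List.In f fs -> x \in xs -> f x = 0) ->
  (forall v x, v \notin xs ++ [:: s; t] -> x \in xs -> R v x = 0) ->
  sp (put_rows (xs ++ [:: s; t]) rows (map (@unit_row V) xs ++ fs) R) =
  \sum_(i < size fs) \sum_(j < size fs) laplace (size xs) rows i j *
    sp (upd_row (upd_row (foldl (fun R x => upd_row R x (unit_row x)) R xs)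
        t (nth (fun=> 0) fs j)) s (nth (fun=> 0) fs i)).
Proof.
elim: xs R rows => [|x xs IH] R rows /=.
  rewrite inE andbT => st; case: rows => [|a [|b [|]]] //= _ /and3P[/eqP sa /eqP sb _] fs0 R0.
  rewrite (signed_perm_row_sum _ _ (fun y => @lin_combE _ _ y sa)).
  apply: eq_bigr => i _.
  rewrite (eq_signed_perm _ (upd_rowC _ _ _ _)) 1?eq_sym //.
  rewrite (eq_signed_perm _ (C := upd_row (upd_row R s (nth (fun=>0) fs i)) t (lin_comb b fs))); last first.
    by move=> v y; rewrite /upd_row; case: eqP => // _; case: eqP.
  rewrite (signed_perm_row_sum _ _ (fun y => @lin_combE _ _ y sb)) big_distrr /=.
  apply: eq_bigr => j _; rewrite mulrA; congr (_ * _).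
  by apply: eq_signed_perm; apply: upd_rowC.
move=> /andP[xvs uvs]; case: rows => [|[|h rx] rest] //=.
move=> [szr] /andP[szh allr] fs0 R0.
have szv : size rest = size (xs ++ [:: s; t]) by rewrite size_cat addn2.
rewrite signed_perm_put_cons //; first last.
- by apply/allP => r /(allP allr); case: r.
- by move=> v vv; apply: R0; rewrite ?mem_head.
- move=> f /(@List.in_app_or _ _ _ _)[|fin]; last by apply: fs0; rewrite ?mem_head.
  elim: (xs) xvs => //= y ys IHy; rewrite inE negb_or => /andP[xy xys] [<-|]; last exact: IHy.
  by rewrite /unit_row (negbTE xy).
have IH' rows' : size rows' = (size xs).+2 ->
    all (fun a : seq int => size a == size xs + size fs)%N rows' ->
    sp (put_rows (xs ++ [:: s; t]) rows' (map (@unit_row V) xs ++ fs)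
      (upd_row R x (unit_row x))) =
    \sum_(i < size fs) \sum_(j < size fs) laplace (size xs) rows' i j *
    sp (upd_row (upd_row (foldl (fun R x => upd_row R x (unit_row x))
        (upd_row R x (unit_row x)) xs)
        t (nth (fun=> 0) fs j)) s (nth (fun=> 0) fs i)).
  move=> sz al; apply: IH => //.
    by move=> f y fin yxs; apply: fs0; rewrite ?inE ?yxs ?orbT.
  move=> v y vv yxs; rewrite /upd_row; case: eqP => [vx|/eqP vx].
    rewrite /unit_row; case: eqP => // yx.
    by move: xvs; rewrite mem_cat -yx yxs.
  by apply: R0; rewrite inE ?negb_or ?vx // yxs orbT.
have szb : size (map behead rest) = (size xs).+2 by rewrite size_map.
have alb : all (fun a : seq int => size a == size xs + size fs)%N (map behead rest).
  by rewrite all_map; apply/allP => r /(allP allr) /=; case: r => //= c r; rewrite addSn.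
have szk (k : 'I_(size rest)) : size (set_nth [::] (map behead rest) k rx) = (size xs).+2.
  by rewrite size_set_nth szb (maxn_idPr _) //; case: k => k /=; rewrite szr.
have alk (k : 'I_(size rest)) :
    all (fun a : seq int => size a == size xs + size fs)%N (set_nth [::] (map behead rest) k rx).
  apply/(all_nthP [::]) => i; rewrite szk => il; rewrite nth_set_nth /=.
  have [_|_] := eqVneq i k; first by move: szh; rewrite addSn.
  by move/(all_nthP [::]): alb => alb'; apply: alb'; rewrite szb.
rewrite IH' // [X in _ + e * X](eq_bigr _ (fun k _ => congr1 _ (IH' _ (szk k) (alk k)))).
have lapE i j : (if h == 0 then 0 else h * laplace (size xs) (map behead rest) i j) +
    e * foldr (fun k acc => (if head 0 (nth [::] rest k) == 0 then 0 else
           head 0 (nth [::] rest k) *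
             laplace (size xs) (set_nth [::] (map behead rest) k rx) i j) + acc)
         0 (iota 0 (size rest)) =
    h * laplace (size xs) (map behead rest) i j + e * \sum_(k < size rest)
      head 0 (nth [::] rest k) * laplace (size xs) (set_nth [::] (map behead rest) k rx) i j.
  have if0 (c d : int) : (if c == 0 then 0 else c * d) = c * d.
    by case: eqP => // ->; rewrite mul0r.
  rewrite if0; congr (_ + e * _).
  rewrite -(big_mkord xpredT (fun k => head 0 (nth [::] rest k) *
    laplace (size xs) (set_nth [::] (map behead rest) k rx) i j)) unlock /index_iota subn0.
  by elim: (iota 0 _) => //= k ks ->; rewrite if0.
under [RHS]eq_bigr do under eq_bigr do rewrite lapE mulrDl -mulrA -(mulrA e) mulr_suml.
under [RHS]eq_bigr do rewrite big_split -!mulr_sumr.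
rewrite big_split -!mulr_sumr; congr (_ + e * _).
under [RHS]eq_bigr do rewrite exchange_big.
rewrite [RHS]exchange_big; apply: eq_bigr => k _ /=.
rewrite mulr_sumr; apply: eq_bigr => i _.
by rewrite mulr_sumr; apply: eq_bigr => j _; rewrite mulrA.
Qed.
End Laplace.

(** * Removal of isolated vertices *)

Section ExtendPerm.
Variables (S V : finType) (h : S -> V).
Hypothesis h_inj : injective h.

Definition extend_fun (s : S -> S) (v : V) : V :=
  if [pick i | h i == v] is Some i then h (s i) else v.

Lemma extend_funE s i : extend_fun s (h i) = h (s i).
Proof.
rewrite /extend_fun; case: pickP => [j /eqP/h_inj -> //|/(_ i)].
by rewrite eqxx.
Qed.

Lemma extend_funN s v : v \notin codom h -> extend_fun s v = v.
Proof.
rewrite /extend_fun; case: pickP => // i /eqP <-.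
by rewrite codom_f.
Qed.

Lemma extend_fun_inj (s : {perm S}) : injective (extend_fun s).
Proof.
apply: (can_inj (g := extend_fun (s^-1)%g)) => v.
have [/codomP[i ->]|vh] := boolP (v \in codom h); last by rewrite !extend_funN.
by rewrite !extend_funE permK.
Qed.

Definition extend_perm (s : {perm S}) : {perm V} := perm (@extend_fun_inj s).

Lemma extend_permM (s t : {perm S}) :
  extend_perm (s * t)%g = (extend_perm s * extend_perm t)%g.
Proof.
apply/permP => v; rewrite permM !permE.
have [/codomP[i ->]|vh] := boolP (v \in codom h); last by rewrite !extend_funN.
by rewrite !extend_funE permM.
Qed.

Lemma extend_perm_tperm x y : extend_perm (tperm x y) = tperm (h x) (h y).
Proof.
apply/permP => v; rewrite permE.
have [/codomP[i ->]|vh] := boolP (v \in codom h); last first.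
  by rewrite extend_funN // tpermD //; apply: contraNneq vh => <-; rewrite codom_f.
rewrite extend_funE; case: tpermP => [->|->|ix iy]; rewrite ?tpermL ?tpermR //.
by rewrite tpermD // => [|]; rewrite eq_sym (inj_eq h_inj); apply/eqP.
Qed.

(** Extension is multiplicative and sends transpositions to transpositions, so a factorization into
    transpositions carries the parity over. *)
Lemma odd_extend_perm (s : {perm S}) : extend_perm s = s :> bool.
Proof.
have [ts -> /allP dts] := prod_tpermP s.
elim: ts dts => [|t ts IH] dts.
  rewrite !big_nil; have -> : extend_perm 1 = 1%g by apply: (mulgI (extend_perm 1)); rewrite -extend_permM !mulg1.
  by rewrite !odd_perm1.
rewrite !big_cons extend_permM !odd_permM extend_perm_tperm !odd_tperm (inj_eq h_inj).
by rewrite IH // => u uts; apply: dts; rewrite inE uts orbT.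
Qed.

(** A contributing permutation fixes all points outside the image of [h]; hence it permutes the
    image and is an extension. *)
Lemma signed_perm_inj (e : int) (B : V -> V -> int) :
  (forall v, v \notin codom h -> B v =1 unit_row v) ->
  signed_perm e B = signed_perm e (fun i j => B (h i) (h j)).
Proof.
move=> Bh; have ext_inj : injective extend_perm.
  move=> s t /permP E; apply/permP => i; apply: h_inj.
  by have := E (h i); rewrite !permE !extend_funE.
rewrite /signed_perm (bigID (mem (extend_perm @: [set: {perm S}]))) /=.
rewrite [X in _ + X]big1 ?addr0; last first.
  move=> s sN; suff [v vh sv] : exists2 v, v \notin codom h & s v != v.
    by rewrite (bigD1 v) //= Bh // /unit_row (negbTE sv) mul0r mulr0.
  apply/exists_inP; apply: contraNT sN; rewrite negb_exists_in => /forall_inP fix_s.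
  have {}fix_s v : v \notin codom h -> s v = v by move=> /fix_s; rewrite negbK => /eqP.
  have im i : {j | s (h i) = h j}.
    apply: sig_eqW; have [/codomP[j ->]|sh] := boolP (s (h i) \in codom h); first by exists j.
    by have /perm_inj E := fix_s _ sh; move: sh; rewrite E codom_f.
  have t_inj : injective (fun i => sval (im i)).
    move=> i j; case: (im i) (im j) => [a /= Ha] [b /= Hb] E; apply/h_inj/(@perm_inj _ s).
    by rewrite Ha Hb E.
  apply/imsetP; exists (perm t_inj); first by rewrite inE.
  apply/permP => v; rewrite permE.
  have [/codomP[i ->]|vh] := boolP (v \in codom h); last by rewrite extend_funN // fix_s.
  by rewrite extend_funE permE; case: (im i).
rewrite big_imset; last by move=> s t _ _; apply: ext_inj.
apply: eq_big => [s|s _]; first by rewrite inE.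
rewrite odd_extend_perm; congr (_ * _).
rewrite (bigID (mem (codom h))) /= [X in _ * X]big1 ?mulr1; last first.
  by move=> v vh; rewrite Bh // permE extend_funN // /unit_row eqxx.
rewrite -big_uniq; last by rewrite map_inj_uniq ?enum_uniq.
rewrite /codom /image_mem big_map big_enum.
by apply: eq_bigr => i _; rewrite permE extend_funE.
Qed.

End ExtendPerm.

(** * Elimination of the cells *)

(** Two rows are parameters: that of vertex 7, which depends on the input weight, and that of the
    vertex below, which is missing in the last grid row. By linearity two numerical choices for each
    are enough. *)
Definition cell_rows (e : int) (ru rq : seq int) : seq (seq int) :=
  [:: [:: e; 0; 1; 0; 0; 0; 0; 0; 0;  0; 0; 0; 0];
      [:: 0; e; 1; 0; 1; 0; 0; 0; 0;  0; 0; 0; 0];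
      [:: 0; 0; e; 0; 0; 0; 0; 0; 0;  0; 0; 1; 0];
      [:: 0; 1; 0; e; -1; 0; 0; 0; 0;  0; 0; 0; 0];
      [:: 0; 0; 0; -1; e; 1; 0; 0; 0;  0; 0; 0; 0];
      [:: 0; 0; 0; 1; 0; e; 1; 0; 0;  0; 0; 0; 0];
      [:: 0; 0; 0; 0; 0; 0; e; 0; 0;  0; 0; 0; 1];
      ru;
      [:: 0; 0; 0; 0; 0; 1; -1; 0; e;  0; 0; 0; 0];
      [:: 0; 0; 0; 0; 0; 0; 0; e; 0;  1; 0; 0; 0];
      rq].

Definition row_u0 (e : int) : seq int := [:: 0; 1; -1; 0; 0; 0; 0; e; 0;  0; 0; 0; 0].
Definition row_w : seq int := [:: 1; 0; 0; 0; 0; 0; 0; 0; 0;  0; 0; 0; 0].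
Definition row_q0 : seq int := [:: 0; 0; 0; 0; 0; 0; 0; 0; 0;  0; 1; 0; 0].
Definition row_c : seq int := [:: 0; 0; 0; 0; 0; 0; 0; 0; 1;  0; 0; 0; 0].

(** Indices 0 to 3 stand for idle terminal, idle lower vertex, column exit and row exit. An idle
    cell gives [e] and a lone row wire goes straight on. With both wires in use their ends come out
    exchanged with weight [e], which a swap of two rows repairs. A row turning into a column already
    in use gives 0. *)
Lemma laplace_cell (e : int) (s t : 'I_4) : e = 1 \/ e = -1 ->
  [/\ laplace e 9 (cell_rows e (row_u0 e) row_q0) s t =
        nth 0 (nth [::] [:: [:: 0; e; 0; 0]; [::]; [::]; [:: 0; 1; 0; 0]] s) t,
      laplace e 9 (cell_rows e (row_u0 e) row_c) s t =
        nth 0 (nth [::] [:: [:: 0; 0; e; 0]; [::]; [:: 0; 0; 0; e]; [::]] s) t,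
      laplace e 9 (cell_rows e row_w row_q0) s t =
        nth 0 (nth [::] [:: [::]; [::]; [:: 0; 1; 0; 0]; [::]] s) t
    & laplace e 9 (cell_rows e row_w row_c) s t = 0].
Proof.
by case=> ->; case: s t => [[|[|[|[|//]]]] ?] [[|[|[|[|//]]]] ?]; split;
  apply/eqP; vm_compute.
Qed.

(** Combines the four tables into the expansion for direct edges that replace the cell: [s] to [N]
    with weight [al], [s] to [E], and [q] to [N]. Leaving [F] and [T] abstract reduces the claim to
    arithmetic in [e]. *)
Lemma laplace_cell_sum (e eta al : int) (A : Type) (z s q N E : A) (F : A -> A -> int)
    (T : seq int -> seq int -> int) :
  e = 1 \/ e = -1 -> F N E = e * F E N ->
  (forall ru rq, size ru = 13%N -> size rq = 13%N -> T ru rq =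
    \sum_(x < 4) \sum_(y < 4) laplace e 9 (cell_rows e ru rq) x y *
      F (nth z [:: s; q; N; E] x) (nth z [:: s; q; N; E] y)) ->
  T (row_u0 e) row_q0 + eta * T (row_u0 e) row_c +
    al * (T row_w row_q0 + eta * T row_w row_c) =
  e * (F s q + eta * F s N + e * (al * F N q + 1 * (F E q + eta * F E N))).
Proof.
move=> e1 FNE TE; have L (x y : 'I_4) := laplace_cell x y e1.
have {}TE ru rq tab : size ru = 13%N -> size rq = 13%N ->
    (forall x y : 'I_4, laplace e 9 (cell_rows e ru rq) x y = tab (x : nat) (y : nat)) ->
    T ru rq = \sum_(x < 4) \sum_(y < 4) tab x y *
      F (nth z [:: s; q; N; E] x) (nth z [:: s; q; N; E] y).
  by move=> szu szq H; rewrite TE //; apply: eq_bigr => x _; apply: eq_bigr => y _; rewrite H.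
rewrite (TE _ _ (fun x y => nth 0 (nth [::] [:: [:: 0; e; 0; 0]; [::]; [::]; [:: 0; 1; 0; 0]] x) y)) //;
  last by move=> x y; case: (L x y).
rewrite (TE _ _ (fun x y => nth 0 (nth [::] [:: [:: 0; 0; e; 0]; [::]; [:: 0; 0; 0; e]; [::]] x) y)) //;
  last by move=> x y; case: (L x y).
rewrite (TE _ _ (fun x y => nth 0 (nth [::] [:: [::]; [::]; [:: 0; 1; 0; 0]; [::]] x) y)) //;
  last by move=> x y; case: (L x y).
rewrite (TE _ _ (fun x y => 0)) //; last by move=> x y; case: (L x y).
rewrite !big_ord_recl !big_ord0 /= !mul0r !add0r !addr0 FNE.
by case: e1 => ->; ring.
Qed.

Section Sweep.
Variables (e : int) (n : nat) (a : nat -> nat -> int).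
Hypothesis e1 : e = 1 \/ e = -1.

Let e2 : e * e = 1. Proof. by case: e1 => ->. Qed.

Definition swept (r c i j : nat) : bool := ((i < r) || ((i == r) && (j < c)))%N.

Definition progress (r c i : nat) : nat := if (i < r)%N then n else if i == r then c else 0%N.

(* The weights once the cells that precede [(r, c)] in row-major order have been
   eliminated; a grid row [i > 0] is numbered [i.-1] here. *)
Definition swept_weight (r c i j k i' j' k' : nat) : int :=
  if i is i0.+1 then
    if swept r c i0 j then [&& i' == i, j' == j & k' == k]%:R
    else if (k == 2%N) && (k' == 8%N) then
      ((j' == j) && (i' == if swept r.+1 c i0 j then 0%N else i0))%:R
    else weight_val e (a i0 j) (symbol i j k i' j' k')
  else if k == 8%N then
    e * (if i' == 0%N then if (k' == 8%N) && (j' < progress r c j)%N then a j j' else 0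
         else [&& i' == j.+1, j' == progress r c j & k' == 7%N]%:R)
  else [&& i' == 0, j' == j & k' == k]%N%:R.

Definition vertex : Type := ('I_n.+1 * 'I_n * 'I_9)%type.

Definition vertex_mx (f : nat -> nat -> nat -> nat -> nat -> nat -> int) : vertex -> vertex -> int :=
  fun v x => f v.1.1 v.1.2 v.2 x.1.1 x.1.2 x.2.

Lemma swept_weight0 i j k i' j' k' : (j < n)%N -> (k < 9)%N -> (k' < 9)%N ->
  swept_weight 0 0 i j k i' j' k' =
  weight_val e (a i.-1 j) (symbol i j k i' j' k').
Proof.
case: i => [|i0] jn k9 k9'; rewrite /swept_weight.
  rewrite /progress ltn0 /symbol; case: (k == 8%N).
    have -> : (if j == 0%N then 0 else 0)%N = 0%N by case: ifP.
    case: i' => [|i'] /=; first by rewrite andbF mulr0.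
    by case: ifP; rewrite ?mulr1 ?mulr0.
  by case: ifP.
have -> : (if swept 1 0 i0 j then 0 else i0)%N = i0.
  by rewrite /swept ltn0 andbF orbF; case: i0.
rewrite /= /swept !ltn0 !andbF.
have [/andP[/eqP -> /eqP ->]|_] := boolP ((k == 2%N) && (k' == 8%N)); last by [].
rewrite !andbT andbC; case: (eqVneq i' i0.+1) => [->|_] /=.
  by rewrite (gtn_eqF (ltnSn i0)); case: (j' == j); rewrite /= ?andbF.
by rewrite andbC; case: (_ && _).
Qed.

Lemma swept_weight_newrow r i j k i' j' k' : (j < n)%N -> (j' < n)%N ->
  swept_weight r n i j k i' j' k' = swept_weight r.+1 0 i j k i' j' k'.
Proof.
move=> jn jn'; have sw q i1 : swept q n i1 j = swept q.+1 0 i1 j.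
  by rewrite /swept; lia.
have pr : progress r n j = progress r.+1 0 j by rewrite /progress; do !case: ifP; lia.
by case: i => [|i0]; rewrite /swept_weight ?sw ?pr.
Qed.

(** * Elimination of one cell *)

Section Step.
Variables (r c : nat).
Hypotheses (rn : (r < n)%N) (cn : (c < n)%N).

Let i : 'I_n.+1 := Ordinal (rn : (r.+1 < n.+1)%N).
Let j : 'I_n := Ordinal cn.
Let xs : seq vertex := [seq (i, j, k) | k <- enum 'I_9].
(* The only vertices with edges into the cell; [q] is a dummy in the last grid row. *)
Let s : vertex := (ord0, Ordinal rn, inord 8).
Let q : vertex :=
  if (r.+1 < n)%N then (inord r.+2, j, inord 2) else (ord0, j, ord0).
(** In the last grid row no wire enters the cell from below, and the dummy [q] must not lead into
    it. *)
Let eta : int := (r.+1 < n)%:R.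
Let M := vertex_mx (swept_weight r c).
(** The direct edges to terminals that [s] has inherited from the eliminated cells of its row. *)
Let s0 (x : vertex) : int :=
  e * (if x.1.1 == 0%N :> nat then
         if (x.2 == 8%N :> nat) && (x.1.2 < c)%N then a r x.1.2 else 0 else 0).
Let q0 (x : vertex) : int := (if (r.+1 < n)%N then e else 1) * unit_row q x.
Let N : vertex -> int := unit_row (ord0, j, inord 8).
(** Identically 0 in the last grid column, where a row wire that has not turned comes to a dead
    end. *)
Let E (x : vertex) : int := [&& x.1.1 == r.+1 :> nat, x.1.2 == c.+1 :> nat & x.2 == 7%N :> nat]%:R.
Let fs := [:: s0; q0; N; E].
Let syms := map (@unit_row vertex) xs ++ fs.

Lemma cell_comb (l1 l2 : seq int) (x : vertex) : size l1 = 9%N ->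
  lin_comb (l1 ++ l2) syms x =
  (if (x.1.1 == r.+1 :> nat) && (x.1.2 == c :> nat) then nth 0 l1 x.2 else 0) +
  lin_comb l2 fs x.
Proof.
rewrite /syms /xs -map_comp => sz1.
have {1}-> : l1 = [seq nth 0 l1 (k : 'I_9) | k <- enum 'I_9].
  by rewrite (map_comp (nth 0 l1) val) val_enum_ord -[RHS]/(mkseq (nth 0 l1) 9) -[X in mkseq _ X]sz1 mkseq_nth.
rewrite -[_ && _]/(x.1 == (i, j)); case: x => ij' k' /=.
suff gen (ks : seq 'I_9) : uniq ks ->
   lin_comb ([seq nth 0 l1 (k : 'I_9) | k <- ks] ++ l2)
     ([seq unit_row (i, j, k) | k <- ks] ++ fs) (ij', k') =
   (if (ij' == (i, j)) && (k' \in ks) then nth 0 l1 k' else 0) + lin_comb l2 fs (ij', k').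
  by rewrite gen ?enum_uniq // mem_enum andbT.
elim: ks => [|k ks IH] /=; first by rewrite andbF add0r.
move=> /andP[kks uks]; rewrite IH // addrA; congr (_ + _).
rewrite /unit_row inE xpair_eqE; case: (ij' == (i, j)) => /=; last by rewrite mulr0 addr0.
have [->|] /= := eqVneq k' k; first by rewrite (negbTE kks) mulr1 addr0.
by rewrite mulr0 add0r.
Qed.

Lemma cell_row_comb (l : seq int) (x : vertex) : size l = 13%N ->
  lin_comb l syms x =
  (if (x.1.1 == r.+1 :> nat) && (x.1.2 == c :> nat) then l`_x.2 else 0) +
  (l`_9 * s0 x + l`_10 * q0 x + l`_11 * N x + l`_12 * E x).
Proof.
move=> sz; rewrite -(cat_take_drop 9 l) cell_comb ?size_take ?sz // !nth_cat size_take sz ltn_ord /=.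
congr (_ + _); rewrite !nth_drop; move: sz.
by do 13![case: l => //= ? l]; case: l => //= _; rewrite !addrA addr0.
Qed.

Let swept_self : swept r c r c = false. Proof. by rewrite /swept; lia. Qed.
Let swept_up : swept r.+1 c r c. Proof. by rewrite /swept; lia. Qed.

Lemma inner_row (k : 'I_9) x : k != 7 :> nat ->
  M (i, j, k) x = lin_comb (nth [::] (cell_rows e [::] [::]) k) syms x.
Proof.
case: x => [[i' j'] k'].
move=> k7; have sz : size (nth [::] (cell_rows e [::] [::]) k) = 13%N.
  by case: k k7 => [[|[|[|[|[|[|[|[|[|//]]]]]]]]] kP].
rewrite cell_row_comb // /M /vertex_mx /swept_weight /N /E /unit_row !xpair_eqE -!val_eqE /=.
rewrite swept_self swept_up inordK //= {sz}.
case: k k7 => [[|[|[|[|[|[|[|[|[|//]]]]]]]]] kP] //= _;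
  rewrite ?mul0r ?add0r ?addr0 ?mul1r /=;
  case: k' => [[|[|[|[|[|[|[|[|[|//]]]]]]]]] k'P] //=;
  rewrite ?andbF ?andbT ?addr0 /=;
  case: (eqVneq (i' : nat) r.+1) => [?|?] /=;
  case: (eqVneq (j' : nat) c) => [?|?] /=;
  rewrite ?andbF ?add0r ?addr0 ?(ltn_eqF (ltnSn _)) ?(gtn_eqF (ltnSn _)) //=;
  repeat case: ifP => //=.
all: try lia.
Qed.

Lemma s_row x : M s x = lin_comb [:: 0; 0; 0; 0; 0; 0; 0; e; 0;  1; 0; 0; 0] syms x.
Proof.
rewrite cell_row_comb //; case: x => [[i' j'] k'].
rewrite /M /vertex_mx /swept_weight /s0 /progress /s inordK //= ltnn eqxx.
rewrite !mul0r !addr0 mul1r.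
case: k' => [[|[|[|[|[|[|[|[|[|//]]]]]]]]] k'P] //=; rewrite ?andbT ?andbF /=;
  case: (eqVneq (i' : nat) 0%N) => [->|?] //=; rewrite ?mulr0 ?add0r ?addr0 ?if_same //=.
by case: (_ && _); rewrite ?mulr1 ?mulr0.
Qed.

Lemma u_row (k : 'I_9) x : k = 7 :> nat -> M (i, j, k) x =
  lin_comb (row_u0 e) syms x + a r c * lin_comb row_w syms x.
Proof.
move=> k7; rewrite !cell_row_comb //; case: x => [[i' j'] k'].
rewrite /M /vertex_mx /swept_weight /= swept_self k7 /=.
rewrite !mul0r !addr0.
case: k' => [[|[|[|[|[|[|[|[|[|//]]]]]]]]] k'P] /=;
  case: (eqVneq (i' : nat) r.+1) => [?|?] /=;
  case: (eqVneq (j' : nat) c) => [?|?] /=;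
  rewrite ?andbF ?andbT ?mulr0 ?mulr1 ?add0r ?addr0 //=; repeat case: ifP => //=; lia.
Qed.

Lemma q_row x : M q x = lin_comb row_q0 syms x + eta * lin_comb row_c syms x.
Proof.
rewrite !cell_row_comb //; case: x => [[i' j'] k'].
rewrite /M /vertex_mx /q0 /q /eta /swept_weight; case: ifP => rn2 /=; last first.
  rewrite !mul0r !mul1r !addr0 /unit_row !xpair_eqE -!val_eqE /= -andbA.
  by case: k' => [[|[|[|[|[|[|[|[|[|//]]]]]]]]] k'P] /=; rewrite ?if_same ?add0r.
rewrite !inordK ?ltnS //= /unit_row !xpair_eqE -!val_eqE /= !inordK ?ltnS //=.
have -> : swept r c r.+1 c = false by rewrite /swept; lia.
have -> : swept r.+1 c r.+1 c = false by rewrite /swept; lia.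
rewrite !mul0r !addr0 mul1r.
case: k' => [[|[|[|[|[|[|[|[|[|//]]]]]]]]] k'P] /=;
  rewrite ?andbF ?andbT ?mulr0 ?mulr1 ?if_same ?addr0 ?add0r //=;
  case: (eqVneq (i' : nat) r.+2) => [?|?] /=;
  case: (eqVneq (j' : nat) c) => [?|?] /=;
  rewrite ?andbF ?andbT ?mulr0 ?mulr1 ?add0r ?addr0 //=; repeat case: ifP => //=; lia.
Qed.

Let size_xs : size xs = 9%N. Proof. by rewrite size_map size_enum_ord. Qed.

Let xsE (v : vertex) : (v \in xs) = (v.1 == (i, j)).
Proof.
apply/mapP/eqP => [[k _ ->] //|]; case: v => ij k /= ->.
by exists k; rewrite ?mem_enum.
Qed.

Let s_xs : s \notin xs. Proof. by rewrite xsE xpair_eqE -!val_eqE. Qed.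
Let q_xs : q \notin xs.
Proof.
rewrite xsE /q; case: ifP => rn2; rewrite xpair_eqE -!val_eqE //= inordK ?ltnS //.
by rewrite (gtn_eqF (ltnSn _)).
Qed.
Let s_neq_q : s != q.
Proof.
rewrite /s /q; case: ifP => rn2; rewrite !xpair_eqE -!val_eqE /= !inordK ?ltnS //=.
by rewrite andbF.
Qed.

Let uniq_vs : uniq (xs ++ [:: s; q]).
Proof.
rewrite cat_uniq map_inj_uniq ?enum_uniq /=; last by move=> k k' [].
by rewrite orbF negb_or s_xs q_xs inE s_neq_q.
Qed.

Let fs_xs f x : List.In f fs -> x \in xs -> f x = 0.
Proof.
rewrite xsE; case: x => [[i' j'] k'] /= + /eqP[-> ->].
have q_neq : unit_row q (i, j, k') = 0.
  by rewrite /unit_row; case: eqP => // qE; move: q_xs; rewrite -qE xsE eqxx.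
case=> [<-|[<-|[<-|[<-|//]]]]; rewrite /s0 /q0 /N /E /= ?q_neq ?mulr0 //.
by rewrite (ltn_eqF (ltnSn c)) andbF.
Qed.

Let not_vs (v : vertex) : v \notin xs ++ [:: s; q] ->
  [/\ ~ (v.1.1 = r.+1 :> nat /\ v.1.2 = c :> nat),
      ~ (v.1.1 = 0%N :> nat /\ v.1.2 = r :> nat /\ v.2 = 8%N :> nat)
    & ~ (v.1.1 = r.+2 :> nat /\ v.1.2 = c :> nat /\ v.2 = 2%N :> nat)].
Proof.
rewrite mem_cat !inE !negb_or xsE => /and3P[vxs vs vq]; split.
- by move=> [H1 H2]; move/eqP: vxs; apply; case: v {vs vq} H1 H2 => [[i' j'] k'] /= H1 H2;
    congr (_, _); apply: val_inj.
- move=> [H1 [H2 H3]]; move/eqP: vs; apply; case: v {vxs vq} H1 H2 H3 => [[i' j'] k'] /= H1 H2 H3.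
  by congr (_, _, _); apply: val_inj; rewrite //= ?inordK.
move=> [H1 [H2 H3]]; move/eqP: vq; apply.
have rn2 : (r.+1 < n)%N by rewrite -ltnS -H1 -ltnS ltnS ltn_ord.
rewrite /q rn2; case: v {vxs vs} H1 H2 H3 => [[i' j'] k'] /= H1 H2 H3.
by congr (_, _, _); apply: val_inj; rewrite //= ?inordK.
Qed.

(** The left neighbour has been eliminated and its outgoing row wire now starts at [s], so apart
    from the cell itself only [s] and the vertex below point into the cell. *)
Let others0 v x : v \notin xs ++ [:: s; q] -> x \in xs -> M v x = 0.
Proof.
move=> /not_vs[]; rewrite xsE; case: v x => [[[iv iP] [jv jP]] kv] [[i' j'] k'] /= vxs vs vq /eqP[-> ->].
rewrite /M /vertex_mx /swept_weight /symbol /swept /progress /=.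
case: iv iP vxs vs vq => [|i0] iP vxs vs vq /=.
  case: (eqVneq (kv : nat) 8%N) => [k8|//].
  by case: and3P => [[/eqP ? /eqP]|_]; rewrite ?mulr0 //; do !case: ifP; lia.
case: ifP => sw; first by case: and3P => // -[/eqP ? /eqP ?]; lia.
case: ifP => [/andP[/eqP k2 _]|kk].
  by case: andP => // -[/eqP ? /eqP]; case: ifP; lia.
rewrite ifF; last by apply/negP => /andP[/eqP + /eqP]; lia.
rewrite ifF; last by apply/negP => /and4P[/eqP + /eqP]; lia.
by rewrite ifF //; apply/negP => /and4P[_ _ H1 H2]; move: kk; rewrite H1 H2.
Qed.

Definition cell_outcome (f g : vertex -> int) : int :=
  signed_perm e (upd_row (upd_row (foldl (fun R x => upd_row R x (unit_row x)) M xs) q g) s f).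

Lemma sweep_term ru rq : size ru = 13%N -> size rq = 13%N ->
  signed_perm e (upd_row (upd_row M (i, j, inord 7) (lin_comb ru syms)) q (lin_comb rq syms)) =
  \sum_(x < 4) \sum_(y < 4) laplace e 9 (cell_rows e ru rq) x y *
    cell_outcome (nth (fun=> 0) fs x) (nth (fun=> 0) fs y).
Proof.
move=> szu szq.
have szr : size (cell_rows e ru rq) = (size xs).+2 by rewrite size_xs.
have alr : all (fun l : seq int => size l == size xs + size fs)%N (cell_rows e ru rq).
  by rewrite size_xs /cell_rows /= szu szq.
have := laplaceP e2 uniq_vs szr alr fs_xs others0; rewrite size_xs => <-.
apply: eq_signed_perm => v; have [vvs|vvs] := boolP (v \in xs ++ [:: s; q]); last first.
  rewrite put_rowsN //; move: vvs; rewrite mem_cat !inE !negb_or xsE /upd_row.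
  case/and3P=> vxs _ /negbTE ->; case: eqP => // vE.
  by move: vxs; rewrite vE eqxx.
rewrite -(nth_index s vvs) put_rows_nth ?index_mem //; last first.
  by rewrite size_cat size_xs.
move: vvs; rewrite mem_cat => /orP[vxs|].
  rewrite nth_cat index_cat vxs index_mem vxs nth_index //.
  move: vxs q_xs; case/mapP => k _ -> q_xs'; rewrite index_map; last by move=> ? ? [].
  rewrite index_enum_ord /upd_row.
  move=> y; rewrite ifN; last by apply: contraNneq q_xs' => <-; rewrite xsE.
  rewrite xpair_eqE eqxx /=; case: ifP => [/eqP ->|k7]; first by rewrite inordK.
  rewrite inner_row; last by apply: contraFN k7 => /eqP k7; apply/eqP/val_inj; rewrite /= inordK.
  congr (lin_comb _ _ _); move/negP: k7; case: k {q_xs'} => [[|[|[|[|[|[|[|[|[|//]]]]]]]]] kP] //= [].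
  by apply/eqP/val_inj; rewrite /= inordK.
have idx w : w \notin xs -> index w (xs ++ [:: s; q]) = (9 + index w [:: s; q])%N.
  by move=> wxs; rewrite index_cat (negbTE wxs) size_xs.
rewrite !inE => /orP[]/eqP -> y.
  rewrite nth_index ?mem_cat ?mem_head ?orbT // idx //= eqxx /upd_row (negbTE s_neq_q).
  have -> : s == (i, j, inord 7) = false by rewrite !xpair_eqE -val_eqE.
  exact: s_row.
rewrite nth_index ?mem_cat ?inE ?eqxx ?orbT // idx //= (negbTE s_neq_q) eqxx /upd_row eqxx.
by [].
Qed.

Let foldl_unit (R : vertex -> vertex -> int) (ys : seq vertex) v :
  foldl (fun R x => upd_row R x (unit_row x)) R ys v = if v \in ys then unit_row v else R v.
Proof.
elim: ys R => //= y ys IH R; rewrite IH inE /upd_row.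
by case: (v \in ys) => /=; rewrite ?orbT ?orbF //; case: eqP => // ->.
Qed.

Let swept_next : swept r c.+1 r c. Proof. by rewrite /swept; lia. Qed.

Lemma swept_frame v x : v \notin xs ++ [:: s; q] ->
  vertex_mx (swept_weight r c.+1) v x = M v x.
Proof.
move/not_vs; case: v x => [[[iv iP] [jv jP]] kv] [[[i' iP'] [j' jP']] k'] /= [vxs vs vq].
rewrite /M /vertex_mx /swept_weight /=.
case: iv iP vxs vs vq => [|i0] iP vxs vs vq.
  case: (eqVneq (kv : nat) 8%N) => [k8|//].
  have -> // : progress r c.+1 jv = progress r c jv.
  by rewrite /progress; do !case: ifP; lia.
have -> : swept r c.+1 i0 jv = swept r c i0 jv by rewrite /swept; lia.
case: ifP => // _; case: ifP => // /andP[/eqP k2 _].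
have -> // : swept r.+1 c.+1 i0 jv = swept r.+1 c i0 jv.
by rewrite /swept; lia.
Qed.

Lemma swept_mx_next :
  vertex_mx (swept_weight r c.+1) =2
  upd_row (upd_row (foldl (fun R x => upd_row R x (unit_row x)) M xs) q
    (fun x => 1 * q0 x + eta * N x)) s
    (fun x => 1 * s0 x + e * (a r c * N x + 1 * E x)).
Proof.
move=> v x; have [vvs|vvs] := boolP (v \in xs ++ [:: s; q]); last first.
  rewrite swept_frame //; move: vvs; rewrite /upd_row foldl_unit mem_cat !inE !negb_or.
  by case/and3P=> /negbTE-> /negbTE-> /negbTE->.
move: vvs; rewrite mem_cat !inE => /orP[vxs|/orP[]/eqP->]; rewrite /upd_row foldl_unit.
- have -> : v == s = false by apply: contraNF s_xs => /eqP <-.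
  have -> : v == q = false by apply: contraNF q_xs => /eqP <-.
  rewrite vxs; move: vxs; rewrite xsE; case: v x => [[i1 j1] k] [[i' j'] k'] /= /eqP[-> ->].
  by rewrite /vertex_mx /swept_weight /= swept_next /unit_row !xpair_eqE -!val_eqE /= andbA.
- rewrite eqxx; case: x => [[i' j'] k']; rewrite /vertex_mx /swept_weight /= inordK //=.
  rewrite /s0 /N /E /unit_row !xpair_eqE -!val_eqE /= inordK // /progress ltnn eqxx.
  rewrite ltnS leq_eqVlt.
  case: (eqVneq (i' : nat) 0%N) => [->|i'0] /=.
    case: (eqVneq (k' : nat) 8%N) => [_|_] /=; last by rewrite andbF mulr0n; ring.
    rewrite andbT; case: (eqVneq (j' : nat) c) => [->|jc] /=.
      by rewrite ltnn mulr1n; ring.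
    by rewrite mulr0n; case: ifP => _; ring.
  by ring.
rewrite eq_sym (negbTE s_neq_q) eqxx; case: x => [[i' j'] k'].
rewrite /q0 /q /eta /N /vertex_mx /swept_weight; case: ifP => rn2 /=; last first.
  by rewrite /unit_row !xpair_eqE -!val_eqE /= -andbA; ring.
rewrite /unit_row !xpair_eqE -!val_eqE /= !inordK ?ltnS //=.
have -> : swept r c.+1 r.+1 c = false by rewrite /swept; lia.
have -> : swept r.+1 c.+1 r.+1 c by rewrite /swept; lia.
rewrite !mul1r;
case: k' => [[|[|[|[|[|[|[|[|[|//]]]]]]]]] k'P] /=;
  rewrite ?andbF ?andbT ?mulr0 ?mulr1 ?if_same ?addr0 ?add0r //=;
  case: (eqVneq (i' : nat) r.+2) => [?|?] /=;
  case: (eqVneq (j' : nat) c) => [?|?] /=;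
  rewrite ?andbF ?andbT ?mulr0 ?mulr1 ?add0r ?addr0 //=; repeat case: ifP => //=; lia.
Qed.

Lemma sweep_cell :
  signed_perm e M = e * signed_perm e (vertex_mx (swept_weight r c.+1)).
Proof.
have uq : (i, j, inord 7) != q by apply: contraNneq q_xs => <-; rewrite xsE.
have [T defT] : exists T : seq int -> seq int -> int, forall ru rq, T ru rq = signed_perm e
    (upd_row (upd_row M (i, j, inord 7) (lin_comb ru syms)) q (lin_comb rq syms)).
  by eexists.
have -> : signed_perm e M =
    T (row_u0 e) row_q0 + eta * T (row_u0 e) row_c +
    a r c * (T row_w row_q0 + eta * T row_w row_c).
  have Tq ru : signed_perm e (upd_row (upd_row M (i, j, inord 7) (lin_comb ru syms)) q
      (fun x => 1 * lin_comb row_q0 syms x + eta * lin_comb row_c syms x)) =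
      T ru row_q0 + eta * T ru row_c.
    by rewrite signed_perm_row_lin mul1r !defT.
  rewrite -(Tq (row_u0 e)) -(Tq row_w) -[X in X + _]mul1r.
  rewrite !(eq_signed_perm _ (upd_rowC _ _ _ uq)) -signed_perm_row_lin.
  apply: eq_signed_perm => v x; rewrite /upd_row; case: eqP => [->|_].
    by rewrite mul1r u_row ?inordK.
  by case: eqP => // ->; rewrite mul1r q_row.
have qs : q != s by rewrite eq_sym.
(* Two wires cannot end in the same terminal. This kills the one term of the direct edges that has
   no counterpart in the tables. *)
have C0 : cell_outcome N N = 0.
  apply: (@signed_perm_dep _ _ _ q s (ord0, j, inord 8)) => // y /negbTE yN.
    by rewrite /upd_row (negbTE qs) eqxx /N /unit_row yN.
  by rewrite /upd_row eqxx /N /unit_row yN.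
(* The factor from exchanging the rows of [s] and [q] turns the exchanged ends back into a
   crossing. *)
have CE : cell_outcome N E = e * cell_outcome E N by exact: signed_perm_swap.
have -> : signed_perm e (vertex_mx (swept_weight r c.+1)) =
   cell_outcome s0 q0 + eta * cell_outcome s0 N +
   e * (a r c * cell_outcome N q0 + 1 * (cell_outcome E q0 + eta * cell_outcome E N)).
  rewrite (eq_signed_perm _ swept_mx_next).
  have split2 f : signed_perm e (upd_row (upd_row (foldl (fun R x => upd_row R x (unit_row x)) M xs) q
      (fun x => 1 * q0 x + eta * N x)) s f) = cell_outcome f q0 + eta * cell_outcome f N.
    have CO g : signed_perm e (upd_row (upd_row (foldl (fun R x => upd_row R x (unit_row x)) M xs) s f) q g) =
        cell_outcome f g by apply: eq_signed_perm; exact: upd_rowC.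
    by rewrite (eq_signed_perm _ (upd_rowC _ _ _ qs)) signed_perm_row_lin !CO mul1r.
  rewrite signed_perm_row_lin mul1r split2 signed_perm_row_lin !split2.
  by rewrite C0 mulr0 addr0.
apply: (@laplace_cell_sum e eta (a r c) _ (fun=> 0) s0 q0 N E cell_outcome T e1 CE) => ru rq szu szq.
by rewrite defT sweep_term.
Qed.

End Step.

Lemma sweep_row r : (r < n)%N -> signed_perm e (vertex_mx (swept_weight r 0)) =
  e ^+ n * signed_perm e (vertex_mx (swept_weight r.+1 0)).
Proof.
move=> rn; have -> : signed_perm e (vertex_mx (swept_weight r.+1 0)) =
    signed_perm e (vertex_mx (swept_weight r n)).
  by apply: eq_signed_perm => v x; rewrite /vertex_mx swept_weight_newrow.
suff H c : (c <= n)%N -> signed_perm e (vertex_mx (swept_weight r 0)) =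
    e ^+ c * signed_perm e (vertex_mx (swept_weight r c)) by exact: H.
elim: c => [|c IH] cn; first by rewrite mul1r.
by rewrite IH 1?ltnW // sweep_cell // mulrA -exprSr.
Qed.

Lemma sweep_all : signed_perm e (vertex_mx (swept_weight 0 0)) =
  e ^+ (n * n) * signed_perm e (vertex_mx (swept_weight n 0)).
Proof.
suff H r : (r <= n)%N -> signed_perm e (vertex_mx (swept_weight 0 0)) =
    e ^+ (r * n) * signed_perm e (vertex_mx (swept_weight r 0)) by exact: H.
elim: r => [|r IH] rn; first by rewrite mul1r.
by rewrite IH 1?ltnW // sweep_row // mulrA -exprD mulSn addnC.
Qed.

(** Only the terminals are not isolated any more, and each of their [n] rows carries the factor [e]
    of its outgoing edge. *)
Lemma signed_perm_swept : signed_perm e (vertex_mx (swept_weight n 0)) =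
  e ^+ n * signed_perm e (fun x y : 'I_n => a x y).
Proof.
pose h (x : 'I_n) : vertex := (ord0, x, inord 8).
have h_inj : injective h by move=> x y [].
rewrite (signed_perm_inj h_inj); last first.
  case=> [[i j] k] vh [[i' j'] k'].
  rewrite /vertex_mx /swept_weight /unit_row !xpair_eqE -!val_eqE /= -andbA.
  case: i vh => [[|i0] iP] vh /=; last by rewrite /swept -ltnS iP.
  case: eqP => // k8; case/negP: vh; apply/codomP; exists j.
  by congr (_, _, _); apply: val_inj; rewrite //= inordK.
rewrite /signed_perm big_distrr; apply: eq_bigr => s _ /=.
rewrite mulrCA; congr (_ * _).
have -> : e ^+ n = \prod_(x < n) e by rewrite prodr_const card_ord.
rewrite -big_split /=.
by apply: eq_bigr => x _; rewrite /vertex_mx /swept_weight /= inordK //= /progress !ltn_ord.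
Qed.

Theorem signed_perm_planarized :
  signed_perm e (vertex_mx (fun i j k i' j' k' => weight_val e (a i.-1 j) (symbol i j k i' j' k'))) =
  signed_perm e (fun x y : 'I_n => a x y).
Proof.
transitivity (signed_perm e (vertex_mx (swept_weight 0 0))).
  by apply: eq_signed_perm => v x; rewrite /vertex_mx swept_weight0.
rewrite sweep_all signed_perm_swept mulrA -exprD addnC -mulnS.
(* The cells have produced [n * n] factors [e] and the terminals [n]. *)
have ev : ~~ odd (n * n.+1) by rewrite oddM /= andbN.
by rewrite -(odd_double_half (n * n.+1)) (negbTE ev) add0n -mul2n exprM expr2 e2 expr1n mul1r.
Qed.

End Sweep.

(** * From the integers to non-commutative rings *)

Definition cayley_sum (e : int) (R : pzRingType) (n : nat) (A : 'M[R]_n) : R :=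
  \sum_(s : 'S_n) (e ^+ s)%:~R * \prod_i A i (s i).

Section Transfer.
Variable N : nat.

Definition multiaffine (R : pzRingType) (c : {set 'I_N} -> int) (x : 'I_N -> R) : R :=
  \sum_S (c S)%:~R * \prod_(u in S) x u.

(** At the indicator of [T] the value is the sum of the coefficients of all subsets of [T];
    induction on the cardinality isolates that of [T]. *)
Lemma multiaffine_inj (c d : {set 'I_N} -> int) :
  (forall x : 'I_N -> int, multiaffine c x = multiaffine d x) -> c =1 d.
Proof.
move=> E T; move: {2}_.+1 (ltnSn #|T|) => m; elim: m T => // m IH T Tm.
have prodT (S : {set 'I_N}) : \prod_(u in S) (u \in T)%:R = (S \subset T)%:R :> int.
  have [ST|] := boolP (S \subset T).
    by rewrite big1 // => u uS; rewrite (fintype.subsetP ST u uS).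
  case/subsetPn => u uS uT.
  by rewrite (bigD1 u) //= (negbTE uT) mul0r.
have maT f : multiaffine f (fun u => (u \in T)%:R : int) =
    f T + \sum_(S : {set 'I_N} | S \proper T) f S.
  rewrite /multiaffine (eq_bigr (fun S : {set 'I_N} => if S \subset T then f S else 0)).
    rewrite -big_mkcond (bigD1 T) //=; congr (_ + _); apply: eq_bigl => S.
    by rewrite finset.properEneq andbC.
  by move=> S _; rewrite prodT intz; case: ifP; rewrite ?mulr1 ?mulr0.
have := E (fun u => (u \in T)%:R); rewrite !maT.
rewrite (eq_bigr d) => [/addIr //|S /fintype.proper_card ST].
by apply: IH; apply: leq_trans ST _.
Qed.

Variables (e : int) (slot : 'I_N -> 'I_N -> bool) (K : 'I_N -> 'I_N -> int).

Definition slot_coef (S : {set 'I_N}) : int :=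
  \sum_(s : 'S_N | [set u | slot u (s u)] == S)
    e ^+ s * \prod_(u | ~~ slot u (s u)) K u (s u).

Lemma prod_slots (R : pzRingType) (b : pred 'I_N) (k : 'I_N -> int) (x : 'I_N -> R) (us : seq 'I_N) :
  \prod_(u <- us) (if b u then x u else (k u)%:~R) =
  (\prod_(u <- us | ~~ b u) k u)%:~R * \prod_(u <- us | b u) x u.
Proof.
elim: us => [|u us IH]; first by rewrite !big_nil mulr1.
rewrite !big_cons IH; case: (b u) => /=; last by rewrite intrM mulrA.
by rewrite !mulrA; congr (_ * _); apply: commr_int.
Qed.

(** Permutations are grouped by the set of rows in which they use a variable. The other entries are
    integers, hence central, and leave the product without disturbing the order of the variables. *)
Lemma cayley_sum_slots (R : pzRingType) (x : 'I_N -> R) :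
  cayley_sum e (\matrix_(u, v) if slot u v then x u else (K u v)%:~R) =
  multiaffine slot_coef x.
Proof.
rewrite /cayley_sum (partition_big (fun s : 'S_N => [set u | slot u (s u)]) predT) //=.
apply: eq_bigr => S _; rewrite raddf_sum mulr_suml; apply: eq_bigr => s /eqP <-.
under eq_bigr do rewrite mxE.
rewrite (prod_slots (fun u => slot u (s u)) (fun u => K u (s u))) mulrA -intrM.
by congr (_ * _); apply: eq_bigl => u; rewrite inE.
Qed.

Variables (n : nat) (pos : 'I_n -> 'I_n -> 'I_N).
Hypothesis pos_mono : forall i i' j j' : 'I_n, (i < i')%N -> (pos i j < pos i' j')%N.

Definition graph_coef (S : {set 'I_N}) : int :=
  \sum_(s : 'S_n | [set pos i (s i) | i : 'I_n] == S) e ^+ s.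

(** By [pos_mono] the increasing enumeration of the image meets the elements in the order of [i], so
    nothing is commuted. *)
Lemma prod_graph (R : pzRingType) (x : 'I_N -> R) (f : 'I_n -> 'I_n) :
  \prod_(u in [set pos i (f i) | i : 'I_n]) x u = \prod_i x (pos i (f i)).
Proof.
rewrite -big_filter -(big_map (fun i => pos i (f i)) xpredT x); congr bigop.
apply: (inj_map val_inj); apply: (irr_sorted_eq ltn_trans ltnn).
- rewrite (subseq_sorted ltn_trans (map_subseq _ (filter_subseq _ _))) //.
  by rewrite -[index_enum _]enumT val_enum_ord iota_ltn_sorted.
- rewrite -map_comp -[index_enum _]enumT sorted_map.
  apply: (@sub_sorted _ (relpre val ltn)); first by move=> i i'; apply: pos_mono.
  by rewrite -sorted_map val_enum_ord iota_ltn_sorted.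
move=> m; apply/mapP/mapP => -[u uS ->]; exists u => //.
  by move: uS; rewrite mem_filter => /andP[/imsetP[i _ ->] _]; rewrite map_f ?mem_index_enum.
by case/mapP: uS => i _ ->; rewrite mem_filter mem_index_enum andbT; apply: imset_f.
Qed.

Lemma cayley_sum_graph (R : pzRingType) (x : 'I_N -> R) :
  cayley_sum e (\matrix_(i, j) x (pos i j)) = multiaffine graph_coef x.
Proof.
rewrite /cayley_sum (partition_big (fun s : 'S_n => [set pos i (s i) | i : 'I_n]) predT) //=.
apply: eq_bigr => S _; rewrite raddf_sum mulr_suml; apply: eq_bigr => s /eqP <-.
by rewrite prod_graph; congr (_ * _); apply: eq_bigr => i _; rewrite mxE.
Qed.

(* Each product uses every variable at most once and in increasing order, so an
   identity over the integers determines the coefficients of the ordered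
   monomials and thereby holds over every ring. *)
Lemma cayley_sum_transfer :
  (forall x : 'I_N -> int,
    cayley_sum e (\matrix_(u, v) if slot u v then x u else (K u v)%:~R) =
    cayley_sum e (\matrix_(i, j) x (pos i j))) ->
  forall (R : pzRingType) (x : 'I_N -> R),
    cayley_sum e (\matrix_(u, v) if slot u v then x u else (K u v)%:~R) =
    cayley_sum e (\matrix_(i, j) x (pos i j)).
Proof.
move=> E R x; rewrite cayley_sum_slots cayley_sum_graph.
apply: eq_bigr => S _; congr (_%:~R * _).
by move: S; apply: multiaffine_inj => y; rewrite -cayley_sum_slots -cayley_sum_graph.
Qed.

End Transfer.

(** The number of vertex 7 in the cell of row [i] and column [j]; the successor skips grid row 0. *)
Definition weight_pos (n i j : nat) : nat := (i.+1 * n + j) * 9 + 7.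

Lemma weight_pos_lt n i j : (i < n)%N -> (j < n)%N -> (weight_pos n i j < planar_order n)%N.
Proof.
move=> lin ljn; rewrite /weight_pos /planar_order.
have : (i.+1 * n <= n * n)%N by rewrite leq_mul2r lin orbT.
by rewrite (mulSn n n); move: (i.+1 * n)%N (n * n)%N => p q; lia.
Qed.

Definition weight_ord n (i j : 'I_n) : 'I_(planar_order n) :=
  Ordinal (weight_pos_lt (ltn_ord i) (ltn_ord j)).

Lemma weight_pos_mono n (i i' j j' : 'I_n) : (i < i')%N ->
  (weight_ord i j < weight_ord i' j')%N.
Proof.
move=> ii'; rewrite /= /weight_pos ltn_add2r ltn_pmul2r //.
apply: (@leq_trans (i'.+1 * n)); last exact: leq_addr.
apply: (@leq_trans (i.+2 * n)); last by rewrite leq_mul2r ltnS ii' orbT.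
by rewrite (mulSn i.+1) -addnS addnC leq_add2r.
Qed.

Lemma weight_valE (R : pzRingType) (e : int) (x : R) (w : weight) :
  weight_val e%:~R x w =
  if w is WG then x else (weight_val e 0 w)%:~R.
Proof. by case: w => //=; rewrite rmorphN. Qed.

Section Planarized.
Variables (e : int) (n : nat).
Hypothesis e1 : e = 1 \/ e = -1.
Local Notation N := (planar_order n).

Definition is_slot (u v : 'I_N) : bool := if index_symbol n u v is WG then true else false.

Lemma planarized_mx (R : pzRingType) (x : 'I_N -> R) :
  \matrix_(u < N, v < N) weight_val e%:~R (x u) (index_symbol n u v) =
  \matrix_(u < N, v < N) if is_slot u v then x u
     else (weight_val e 0 (index_symbol n u v))%:~R.
Proof. by apply/matrixP => u v; rewrite !mxE weight_valE /is_slot; case: index_symbol. Qed.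

Lemma order_gt0 (u : 'I_N) : (0 < n)%N.
Proof. by case: u => m; rewrite /planar_order; case: n => //; rewrite muln0. Qed.

Lemma index_row_lt (u : 'I_N) : (u %/ 9 %/ n < n.+1)%N.
Proof. by rewrite ltn_divLR ?(order_gt0 u) // ltn_divLR //; case: u. Qed.

Lemma index_col_lt (u : 'I_N) : (u %/ 9 %% n < n)%N.
Proof. by rewrite ltn_mod (order_gt0 u). Qed.

Definition vertex_of (u : 'I_N) : vertex n :=
  (Ordinal (index_row_lt u), Ordinal (index_col_lt u), Ordinal (ltn_pmod u (isT : (0 < 9)%N))).

Lemma vertex_of_inj : injective vertex_of.
Proof.
move=> u v [E1 E2 E3]; apply: val_inj.
by rewrite /= (divn_eq u 9) (divn_eq v 9) (divn_eq (u %/ 9) n) (divn_eq (v %/ 9) n) E1 E2 E3.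
Qed.

Lemma symbol_slot i j k i' j' k' : symbol i j k i' j' k' = WG -> (0 < i)%N /\ k = 7%N.
Proof.
case: i => [|i]; rewrite /symbol; first by do !case: ifP => //.
do ![case: ifP => // _].
by case: k => [|[|[|[|[|[|[|[|[|k]]]]]]]]]; case: k' => [|[|[|[|[|[|[|[|[|k']]]]]]]]] //=;
   rewrite nth_nil.
Qed.

Lemma cayley_sum_planarized_int (x : 'I_N -> int) :
  cayley_sum e (\matrix_(u < N, v < N) weight_val e (x u) (index_symbol n u v)) =
  cayley_sum e (\matrix_(i < n, j < n) x (weight_ord i j)).
Proof.
have csE m (A : 'M[int]_m) : cayley_sum e A = signed_perm e (fun u v : 'I_m => A u v).
  by apply: eq_bigr => s _; rewrite intz.
(* The sweep takes weights indexed by all natural numbers; the default 0 is never read at a cell of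
   the grid. *)
pose y (i j : nat) := oapp x 0 (insub (weight_pos n i j)).
have yE (i j : 'I_n) : y i j = x (weight_ord i j).
  rewrite /y insubT ?weight_pos_lt //= => lt; congr x; exact: val_inj.
rewrite !csE; transitivity (signed_perm e (fun i j : 'I_n => y i j)); last first.
  by apply: eq_signed_perm => i j; rewrite mxE yE.
(* Here the injection is a bijection, so it only renumbers the vertices and leaves nothing outside
   its image. *)
rewrite -(signed_perm_planarized n y e1) (signed_perm_inj vertex_of_inj); last first.
  move=> v; rewrite inj_card_onto //; first exact: vertex_of_inj.
  by rewrite !card_prod !card_ord.
apply: eq_signed_perm => u v; rewrite mxE /vertex_mx /= /index_symbol.
set w := symbol _ _ _ _ _ _; suff: w = WG -> x u = y (u %/ 9 %/ n).-1%N (u %/ 9 %% n)%N.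
  by case: w => //= ->.
case/symbol_slot => i0 k7.
have lti : ((u %/ 9 %/ n).-1 < n)%N by rewrite -ltnS prednK // index_row_lt.
rewrite -[y _ _]/(y (Ordinal lti) (Ordinal (index_col_lt u))) yE; congr x; apply: val_inj.
by rewrite /= /weight_pos prednK // -(divn_eq (u %/ 9) n) {1}(divn_eq u 9) k7.
Qed.

Theorem cayley_sum_planarized (R : pzRingType) (x : 'I_N -> R) :
  cayley_sum e (\matrix_(u < N, v < N) weight_val e%:~R (x u) (index_symbol n u v)) =
  cayley_sum e (\matrix_(i < n, j < n) x (weight_ord i j)).
Proof.
rewrite planarized_mx.
apply: (cayley_sum_transfer (slot := is_slot) (pos := @weight_ord n)).
  by move=> i i' j j'; apply: weight_pos_mono.
move=> y; rewrite -planarized_mx -cayley_sum_planarized_int.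
by congr cayley_sum; apply/matrixP => u v; rewrite !mxE intz.
Qed.

End Planarized.

(** * The planar drawing *)

(** Unit lattice steps, antidiagonals of unit squares and the return edges from a terminal to the
    start of its row wire. All diagonals have the same direction, so no two of them cross in a
    square. *)
Variant link := Horizontal of nat & nat | Vertical of nat & nat
  | Diagonal of nat & nat | Detour of nat.

Definition ends (l : link) : (nat * nat) * (nat * nat) :=
  match l with
  | Horizontal a b => ((a, b), (a.+1, b))
  | Vertical a b => ((a, b), (a, b.+1))
  | Diagonal a b => ((a.+1, b), (a, b.+1))
  | Detour d => ((d, 0%N), (0%N, d))
  end.

Definition detour (P Q : nat * nat) : bool := [&& (1 < P.1)%N, P.2 == 0%N & Q == (0%N, P.1)].

Section Links.
Variable K : realType.
Implicit Types (P Q : nat * nat) (t : K).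

(* Straight for [b = 0], else a parabola pushed towards the negative quadrant. *)
Definition bent_segment (b : nat) P Q t : K * K :=
  (P.1%:R + t * (Q.1%:R - P.1%:R) - b%:R * (t * (1 - t)),
   P.2%:R + t * (Q.2%:R - P.2%:R) - b%:R * (t * (1 - t))).

(** The factor 4 d makes all return edges homothetic: the one for d lies on the parabola X + Z = 2
    (X - Z)^2 / d - d. *)
Definition bend P Q : nat :=
  if detour P Q then (4 * P.1)%N else if detour Q P then (4 * Q.1)%N else 0%N.

(** For [d = 1] a return edge would have the same ends as [Diagonal 0 0]. *)
Definition valid_link (l : link) : bool := if l is Detour d then (1 < d)%N else true.

Lemma bendC P Q : bend P Q = bend Q P.
Proof.
rewrite /bend /detour; case: P Q => [a b] [c d] /=; rewrite !xpair_eqE /=.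
by do !case: ifP => //; lia.
Qed.

Lemma bent_segmentC b P Q t : bent_segment b P Q t = bent_segment b Q P (1 - t).
Proof. by rewrite /bent_segment; congr (_, _); ring. Qed.

Lemma bend_link l : valid_link l -> bend (ends l).1 (ends l).2 = if l is Detour d then (4 * d)%N else 0%N.
Proof.
rewrite /bend /detour; case: l => [a b|a b|a b|d] /= v; rewrite !xpair_eqE /=.
all: by do !case: ifP => //; lia.
Qed.

Definition on_link (l : link) (X Z : K) : Prop :=
  exists2 t, 0 < t < 1 & bent_segment (bend (ends l).1 (ends l).2) (ends l).1 (ends l).2 t = (X, Z).

Definition link_shape (l : link) (X Z : K) : Prop :=
  exists2 t, 0 < t < 1 & match l with
  | Horizontal a b => X = a%:R + t /\ Z = b%:R
  | Vertical a b => X = a%:R /\ Z = b%:R + t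
  | Diagonal a b => X = a%:R + t /\ Z = b%:R + 1 - t
  | Detour d => X - Z = d%:R * (2 * t - 1) /\ X + Z = d%:R * (2 * (2 * t - 1) ^+ 2 - 1)
  end.

Lemma on_linkP l X Z : valid_link l -> on_link l X Z -> link_shape l X Z.
Proof.
move=> v [t t01]; rewrite bend_link // /bent_segment; case: l v => [a b|a b|a b|d] /= v [<- <-].
- by exists t => //; split; rewrite ?mulrS; ring.
- by exists t => //; split; rewrite ?mulrS; ring.
- by exists (1 - t); [lra | split; rewrite ?mulrS; ring].
- by exists (1 - t); [lra | split; rewrite natrM; ring].
Qed.

Lemma frac_eq (a b : nat) (s t : K) : 0 < s < 1 -> 0 < t < 1 -> a%:R + s = b%:R + t -> a = b.
Proof.
move=> s01 t01 E; apply/eqP; rewrite eqn_leq -(ltnS a b) -(ltnS b a) -!(ltr_nat K) !mulrS.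
by apply/andP; split; lra.
Qed.

Lemma frac_neq (a b : nat) (t : K) : 0 < t < 1 -> a%:R <> b%:R + t.
Proof.
move=> t01 E; have : (b < a)%N by rewrite -(ltr_nat K); lra.
by rewrite -(ler_nat K) mulrS; lra.
Qed.

(** On the curve X = - d t (3 - 4 t) and Z = - d (1 - t) (4 t - 1); the first is negative for t <
    3/4 and the second for t > 1/4. *)
Lemma detour_outside d X Z : (0 < d)%N -> link_shape (Detour d) X Z -> X < 0 \/ Z < 0.
Proof.
move=> d0 [t t01 [E1 E2]]; have {}d0 : (0 : K) < d%:R by rewrite ltr0n.
set D : K := d%:R in d0 E1 E2; have [t2|t2] := leP (1 / 2) t; [right|left].
  have e : Z * 2 = - (D * ((1 - t) * (4 * t - 1)) * 2).
    by rewrite (_ : Z * 2 = (X + Z) - (X - Z)); [rewrite E1 E2; ring | ring].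
  have : 0 < D * ((1 - t) * (4 * t - 1)) by rewrite mulr_gt0 // mulr_gt0; lra.
  by lra.
have e : X * 2 = - (D * (t * (3 - 4 * t)) * 2).
  by rewrite (_ : X * 2 = (X + Z) + (X - Z)); [rewrite E1 E2; ring | ring].
have : 0 < D * (t * (3 - 4 * t)) by rewrite mulr_gt0 // mulr_gt0; lra.
by lra.
Qed.

Lemma lattice_inside l X Z : (if l is Detour _ then false else true) -> link_shape l X Z ->
  0 <= X /\ 0 <= Z.
Proof.
have p (a : nat) : (0 : K) <= a%:R by rewrite ler0n.
by case: l => [a b|a b|a b|//] _ [t t01 [-> ->]]; have := p a; have := p b; lra.
Qed.

Lemma link_vertex l X Z (a b : nat) : valid_link l -> link_shape l X Z -> (X, Z) <> (a%:R, b%:R).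
Proof.
move=> v sh [Xa Zb]; have [dt|lt] : (exists d, l = Detour d) \/ (if l is Detour _ then false else true).
  by case: (l) => [? ?|? ?|? ?|d]; [right|right|right|left; exists d].
  case: dt => d dE; rewrite dE in v sh.
  have := detour_outside (ltnW v) sh; rewrite Xa Zb.
  by have := ler0n K a; have := ler0n K b; lra.
case: l lt sh {v} => [c d|c d|c d|//] _ [t t01 [E1 E2]].
- by apply: (@frac_neq a c t t01); rewrite -Xa.
- by apply: (@frac_neq b d t t01); rewrite -Zb.
- by apply: (@frac_neq a c t t01); rewrite -Xa.
Qed.

(** Return edges avoid the closed quadrant that contains all other links. Two lattice links of
    different types differ in a coordinate that is integral on one and fractional on the other; for
    equal types the integral parts determine the link. *)
Lemma link_inj l l' X Z : valid_link l -> valid_link l' ->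
  link_shape l X Z -> link_shape l' X Z -> l = l'.
Proof.
have lat m (Y Y' : K) (d : nat) : (1 < d)%N -> (if m is Detour _ then false else true) -> link_shape m Y Y' ->
    link_shape (Detour d) Y Y' -> False.
  by move=> d1 lm /(lattice_inside lm)[? ?] /(detour_outside (ltnW d1)); lra.
case: l l' => [a b|a b|a b|d] [a' b'|a' b'|a' b'|d'] v v' sh sh';
  try by [case: (lat _ _ _ _ v' _ sh sh') | case: (lat _ _ _ _ v _ sh' sh)].
all: move: sh sh' => [t t01 [X1 Z1]] [t' t01' [X2 Z2]].
- by congr Horizontal; [apply: (@frac_eq _ _ t t'); rewrite // -X1 -X2 |
    apply/eqP; rewrite -(eqr_nat K) -Z1 -Z2].
- by case: (@frac_neq b b' t' t01'); rewrite -Z1 -Z2.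
- by case: (@frac_neq b b' (1 - t')); [lra | rewrite -Z1 Z2; ring].
- by case: (@frac_neq b' b t t01); rewrite -Z1 -Z2.
- by congr Vertical; [apply/eqP; rewrite -(eqr_nat K) -X1 -X2 |
    apply: (@frac_eq _ _ t t'); rewrite // -Z1 -Z2].
- by case: (@frac_neq a a' t' t01'); rewrite -X1 -X2.
- by case: (@frac_neq b' b (1 - t)); [lra | rewrite -Z2 Z1; ring].
- by case: (@frac_neq a' a t t01); rewrite -X1 -X2.
- by congr Diagonal; [apply: (@frac_eq _ _ t t'); rewrite // -X1 -X2 |
    apply: (@frac_eq _ _ (1 - t) (1 - t')); lra].
congr Detour; apply/eqP; rewrite -(eqr_nat K).
have p : (0 : K) < d%:R by rewrite ltr0n ltnW.
have p' : (0 : K) < d'%:R by rewrite ltr0n ltnW.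
move: p p' X1 Z1 X2 Z2; move: (d%:R : K) (d'%:R : K) => D D' p p' X1 Z1 X2 Z2.
(* Eliminating X + Z from the equations of the two parabolas leaves the difference of the sizes
   times a positive factor. *)
have E : (D' - D) * (2 * (X - Z) ^+ 2 + D * D') = 0.
  have e1 : D * (X + Z) = 2 * (X - Z) ^+ 2 - D ^+ 2 by rewrite Z1 X1; ring.
  have e2 : D' * (X + Z) = 2 * (X - Z) ^+ 2 - D' ^+ 2 by rewrite Z2 X2; ring.
  transitivity (D' * (2 * (X - Z) ^+ 2 - D ^+ 2) - D * (2 * (X - Z) ^+ 2 - D' ^+ 2)); first by ring.
  by rewrite -e1 -e2; ring.
have pos : 0 < 2 * (X - Z) ^+ 2 + D * D'.
  by rewrite ltr_wpDl ?mulr_gt0 // mulr_ge0 // sqr_ge0.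
by move/eqP: E; rewrite mulf_eq0 (gt_eqF pos) orbF subr_eq0 eq_sym.
Qed.

Lemma bent_segment_continuous b P Q : continuous (bent_segment b P Q).
Proof.
have cont (p q : K) : continuous (fun t : K => p + t * q - b%:R * (t * (1 - t))).
  move=> t; apply: cvgB.
    by apply: cvgD; [exact: cvg_cst | apply: cvgM; [exact: cvg_id | exact: cvg_cst]].
  apply: cvgM; first exact: cvg_cst.
  by apply: cvgM; [exact: cvg_id | apply: cvgB; [exact: cvg_cst | exact: cvg_id]].
by move=> t; apply: (cvg_pair (cont P.1%:R (Q.1%:R - P.1%:R) t) (cont P.2%:R (Q.2%:R - P.2%:R) t)).
Qed.

Definition joins (l : link) P Q : Prop := (ends l = (P, Q) \/ ends l = (Q, P)) /\ valid_link l.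

Lemma joins_interior l P Q t : joins l P Q -> 0 < t < 1 ->
  link_shape l (bent_segment (bend P Q) P Q t).1 (bent_segment (bend P Q) P Q t).2.
Proof.
move=> [e v] t01; apply: on_linkP => //; rewrite /on_link.
case: e => ->; rewrite -surjective_pairing; first by exists t.
by exists (1 - t); [lra | rewrite bendC [RHS]bent_segmentC].
Qed.

(** The bend is the same in both coordinates and cancels in their difference. This difference is
    affine in the parameter, with non-zero slope for every type of link. *)
Lemma joins_inj l P Q : joins l P Q -> injective (bent_segment (bend P Q) P Q).
Proof.
move=> [e v] s t [E1 E2].
have E : (s - t) * ((Q.1%:R - P.1%:R) - (Q.2%:R - P.2%:R)) = 0.
  have /eqP := congr2 (fun x y => x - y) E1 E2; rewrite -subr_eq0 => /eqP <-; ring.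
have [d1|d1] : (Q.1 + P.2 < P.1 + Q.2)%N \/ (P.1 + Q.2 < Q.1 + P.2)%N.
- by move: v; case: e; case: l => [a b|a b|a b|d] /= [<- <-] /=; lia.
all: apply/eqP; rewrite -subr_eq0; move/eqP: E; rewrite mulf_eq0 => /orP[//|/eqP].
all: by move: d1; rewrite -(ltr_nat K) !natrD; lra.
Qed.

(** A link determines its unordered pair of ends, and listing every edge with [i < j] leaves one
    ordered pair; so different edges run along different links. *)
Lemma planar_of_links (N : nat) (pt : 'I_N -> nat * nat) (edge : rel 'I_N) :
  injective pt ->
  (forall i j : 'I_N, (i < j)%N -> edge i j -> exists l, joins l (pt i) (pt j)) ->
  planar_graph K edge.
Proof.
move=> pt_inj J.
exists (fun i => ((pt i).1%:R, (pt i).2%:R)).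
exists (fun i j => bent_segment (bend (pt i) (pt j)) (pt i) (pt j)); split.
- move=> i j [] /eqP; rewrite eqr_nat => /eqP E1 /eqP; rewrite eqr_nat => /eqP E2.
  by apply: pt_inj; rewrite (surjective_pairing (pt i)) E1 E2 -surjective_pairing.
- move=> i j /andP[ij /(J _ _ ij)[l lij]]; split.
  + by apply: continuous_subspaceT; apply: bent_segment_continuous.
  + by rewrite /bent_segment !mul0r !mulr0 !addr0 !subr0.
  + by rewrite /bent_segment !mul1r subrr !mulr0 !subr0 ![_ + (_ - _)]addrC !subrK.
  + by move=> s t _ _; apply: joins_inj lij _ _.
- move=> i j k t /andP[ij /(J _ _ ij)[l lij]] t01 E.
  have := joins_interior lij t01; rewrite E => sh.
  exact: (link_vertex lij.2 sh erefl).
move=> i j k l s t /andP[ij /(J _ _ ij)[m mij]] /andP[kl /(J _ _ kl)[m' mkl]] ne s01 t01 E.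
have := joins_interior mij s01; rewrite E => sh.
have mm := link_inj mij.2 mkl.2 sh (joins_interior mkl t01).
apply: ne; move: mij mkl; rewrite -mm => -[e _] [e' _].
case: e e' => -> [] [/pt_inj E1 /pt_inj E2]; subst => //; by have := ltn_trans ij kl; rewrite ltnn.
Qed.

End Links.

(** Offsets in a square of side 4. Around vertex 1 the neighbours 7, 4 and 3, 2 lie on opposite
    sides, so the wires cross there; at vertex 5 the column wire bends from 8 to 3 and the row wire
    from 4 to 6, so they only touch. Wires between neighbouring cells become diagonals. *)
Definition kind_x : seq nat := [:: 0; 1; 1; 1; 2; 2; 3; 0; 2]%N.
Definition kind_z : seq nat := [:: 0; 1; 0; 2; 1; 2; 2; 1; 3]%N.

(* The vertices of grid row 0 other than the column ends are isolated and are
   put out of the way. *)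
Definition position (n i j k : nat) : nat * nat :=
  if i is i0.+1 then (4 * j + nth 0 kind_x k, (4 * i0 + nth 0 kind_z k).+1)%N
  else if k == 8%N then ((4 * j).+2, 0)%N else ((4 * n).+1 + (9 * j + k), 0)%N.

Lemma position_inj n i j k i' j' k' : (j < n)%N -> (k < 9)%N -> (j' < n)%N -> (k' < 9)%N ->
  position n i j k = position n i' j' k' -> [/\ i = i', j = j' & k = k'].
Proof.
move=> jn k9 jn' k9'; case: i i' => [|i] [|i'] /=.
- by do 2![case: ifP => [/eqP ?|?]] => -[*]; split; lia.
- by case: ifP => _ [].
- by case: ifP => _ [].
by move: k k' k9 k9' => [|[|[|[|[|[|[|[|[|//]]]]]]]]] [|[|[|[|[|[|[|[|[|//]]]]]]]]] _ _ /= [? ?];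
  split; lia.
Qed.

Definition adjacent (P Q : nat * nat) : bool :=
  [|| (Q.1 == P.1.+1) && (Q.2 == P.2), (Q.1 == P.1) && (Q.2 == P.2.+1),
      (P.1 == Q.1.+1) && (Q.2 == P.2.+1) | [&& (1 < P.1)%N, P.2 == 0, Q.1 == 0 & Q.2 == P.1]]%N.

Lemma adjacent_joins P Q : adjacent P Q || adjacent Q P -> exists l, joins l P Q.
Proof.
wlog: P Q / adjacent P Q => [H /orP[]c|+ _].
- by apply: H; rewrite ?c.
- by have [|l [e v]] := H Q P c; [rewrite c | exists l; split => //; case: e; [right | left]].
case: P Q => [a b] [c d] /or4P[/andP|/andP|/andP|/and4P] /= [].
- by move=> /eqP-> /eqP->; exists (Horizontal a b); split=> //; left.
- by move=> /eqP-> /eqP->; exists (Vertical a b); split=> //; left.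
- by move=> /eqP-> /eqP->; exists (Diagonal c b); split=> //; left.
by move=> a1 /eqP-> /eqP-> /eqP->; exists (Detour a); split=> //; left.
Qed.

Lemma symbol_adjacent n i j k i' j' k' : (k < 9)%N -> (k' < 9)%N ->
  symbol i j k i' j' k' <> W0 -> [&& i == i', j == j' & k == k'] = false ->
  adjacent (position n i j k) (position n i' j' k') || adjacent (position n i' j' k') (position n i j k).
Proof.
case: i => [|i]; rewrite /symbol.
  move=> k9 k9'; case: (eqVneq k 8%N) => [->|k8].
    case: ifP => // /and3P[/eqP -> /eqP -> /eqP ->] _ _.
    (* The terminal lies at (4 j + 2, 0) and the row wire starts at (0, 4 j + 2), at equal distance
       from the origin as a return edge requires. *)
    by apply/orP; left; rewrite /adjacent /=; lia.
  by case: ifP => // /and3P[/eqP -> /eqP -> /eqP ->]; rewrite !eqxx.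
case: ifP => [/andP[/eqP -> /eqP ->]|_].
  rewrite !eqxx /=.
  by move: k k' => [|[|[|[|[|[|[|[|[|//]]]]]]]]] [|[|[|[|[|[|[|[|[|//]]]]]]]]] _ _ //= _ // _;
    rewrite /adjacent /=; lia.
case: ifP => [/and4P[/eqP -> /eqP -> /eqP -> /eqP ->]|_] _ _.
  by move=> _ _; rewrite /adjacent /=; lia.
case: ifP => // /and4P[/eqP -> /eqP -> /eqP -> /eqP ->] _ _.
by case: i => [|i]; rewrite /adjacent /=; lia.
Qed.

Lemma planar_index_symbol (K : realType) (n : nat) :
  planar_graph K (fun u v : 'I_(planar_order n) =>
    (index_symbol n u v != W0) || (index_symbol n v u != W0)).
Proof.
pose pt (u : 'I_(planar_order n)) := position n (u %/ 9 %/ n) (u %/ 9 %% n) (u %% 9).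
have col u := index_col_lt (n := n) u.
have k9 (u : nat) : (u %% 9 < 9)%N by rewrite ltn_mod.
apply: (@planar_of_links _ _ pt).
  move=> u v /position_inj[] // E1 E2 E3; apply: (@vertex_of_inj n).
  by congr (_, _, _); apply: val_inj.
move=> u v uv /orP uv_edge; apply: adjacent_joins.
have ne : [&& u %/ 9 %/ n == v %/ 9 %/ n, u %/ 9 %% n == v %/ 9 %% n & u %% 9 == v %% 9]%N = false.
  apply/negbTE/negP => /and3P[/eqP E1 /eqP E2 /eqP E3].
  suff uvE : u = v by rewrite uvE ltnn in uv.
  by apply: (@vertex_of_inj n); congr (_, _, _); apply: val_inj.
case: uv_edge => [/eqP/(symbol_adjacent n (k9 _) (k9 _))|/eqP/(symbol_adjacent n (k9 _) (k9 _))]; first exact.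
by rewrite orbC; apply; rewrite ![(v %/ 9 %/ n)%N == _]eq_sym ![(v %/ 9 %% n)%N == _]eq_sym ![(v %% 9)%N == _]eq_sym.
Qed.

(** * Correctness *)

Lemma cayley_sum1 (R : pzRingType) n (A : 'M[R]_n) : cayley_sum 1 A = cayley_perm A.
Proof. by apply: eq_bigr => s _; rewrite expr1n mul1r. Qed.

Lemma cayley_sumN1 (R : pzRingType) n (A : 'M[R]_n) : cayley_sum (-1) A = \det A.
Proof. by apply: eq_bigr => s _; congr (_ * _); case: (s : bool). Qed.

Section Correctness.
Variables (K : realType) (c0 c1 cN1 cE : seq bool) (A : coded_algebra c0 c1 cN1) (e : int).
Hypotheses (e1 : e = 1 \/ e = -1) (valueE : value A cE = e%:~R).

Lemma weight_mx_planarize G : weight_mx A (planarize c0 c1 cN1 cE G) =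
  \matrix_(u, v) weight_val e%:~R (value A (vertex_word G u)) (index_symbol (dg_order G) u v).
Proof.
apply/matrixP => u v; rewrite !mxE; case: index_symbol => //=.
- exact: value0.
- exact: value1.
- exact: valueN1.
Qed.

Lemma planar_planarize G : planar_digraph K (weight_mx A (planarize c0 c1 cN1 cE G)).
Proof.
have [p [g [H1 H2 H3 H4]]] := planar_index_symbol K (dg_order G).
(* [W0] always denotes 0, while other symbols may vanish in a particular algebra; the edges thus
   form a subgraph of the one drawn, and the drawing is restricted. *)
have sub (u v : 'I_(planar_order (dg_order G))) : (u < v)%N && ((weight_mx A (planarize c0 c1 cN1 cE G) u v != 0) ||
      (weight_mx A (planarize c0 c1 cN1 cE G) v u != 0)) ->
    (u < v)%N && ((index_symbol (dg_order G) u v != W0) || (index_symbol (dg_order G) v u != W0)).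
  case/andP=> -> /=; rewrite weight_mx_planarize !mxE.
  by case/orP => [ne|ne]; apply/orP; [left|right]; apply: contra_neq ne => ->.
exists p, g; split => //.
- by move=> u v /sub; apply: H2.
- by move=> u v w t /sub; apply: H3.
by move=> u v w x s t /sub uv /sub wx; apply: H4.
Qed.

Lemma cayley_sum_planarize G :
  cayley_sum e (weight_mx A (planarize c0 c1 cN1 cE G)) = cayley_sum e (weight_mx A G).
Proof.
rewrite weight_mx_planarize (cayley_sum_planarized e1 (fun u => value A (vertex_word G u))).
congr cayley_sum; apply/matrixP => i j; rewrite !mxE; congr value.
have n0 : (0 < dg_order G)%N by apply: leq_ltn_trans (ltn_ord i).
rewrite -nth_words /vertex_word /=.
have -> : (weight_pos (dg_order G) i j %/ 9 = i.+1 * dg_order G + j)%N.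
  by rewrite /weight_pos divnMDl // (divn_small (isT : (7 < 9)%N)) addn0.
by rewrite divnMDl // (divn_small (ltn_ord j)) addn0 modnMDl modn_small.
Qed.

End Correctness.

Theorem theorem7 (K : realType) (c0 c1 cN1 : seq bool) :
  many_one_reducible (C_perm c0 c1 cN1) (planar_restriction K (C_perm c0 c1 cN1)) /\
  many_one_reducible (C_det c0 c1 cN1) (planar_restriction K (C_det c0 c1 cN1)).
Proof.
split.
  (* The map is the same in both cases, except that [WE] is written with the code of 1 here and with
     that of -1 for the determinant. *)
  exists (planarize c0 c1 cN1 c1) => [|A G _]; first exact: polytime_planarize.
  have E : value A c1 = (1 : int)%:~R by rewrite value1.
  split; first by split=> //; apply: planar_planarize E _.
  by rewrite /= -!cayley_sum1; apply: cayley_sum_planarize E _; left.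
exists (planarize c0 c1 cN1 cN1) => [|A G _]; first exact: polytime_planarize.
have E : value A cN1 = (- 1 : int)%:~R by rewrite valueN1.
split; first by split=> //; apply: planar_planarize E _.
by rewrite /= -!cayley_sumN1; apply: cayley_sum_planarize E _; right.
Qed.
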